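(* For all positive integers $n$ and all integers $k\ge 0$, \[S_{n,k}=\begin{cases}\displaystyle\sum_{\sigma\in\mathsf{ADR}_{n,k}}t^{\mathsf{revmaj}(\sigma)} & \text{if } n-k \text{ is odd},\\[2mm] 0 & \text{if } n-k \text{ is even.}\end{cases}\]
   Context: Paths. A square path of size $n$ is a lattice path from $(0,0)$ to $(n,n)$ made of unit north (vertical) and east (horizontal) steps whose last step is east; it is a Dyck path if it stays weakly above $y=x$. For $j\in\mathbb Z$, the $j$-th diagonal is the set of unit lattice squares with two vertices on the line $y=x+j$. Each vertical step is identified with the unit square of which it is the left edge. The area word $a=a_1\cdots a_n$ has $a_i=j$ if the $i$-th vertical step starts on the line $y=x+j$ (equivalently, its square lies in the $j$-th diagonal). The shift is $s=-\min_i a_i$ and the area is $\sum_i(a_i+s)$. A labeling is a word $w=w_1\cdots w_n$ of positive integers, $w_i$ written in the square of the $i$-th vertical step, such that labels in a common column strictly increase upward; it is standard if its labels are exactly $1,\dots,n$. The $i$-th vertical step is a contractible valley if ($i>1$ and $a_{i-1}>a_i$) or ($i>1$, $a_{i-1}=a_i$ and $w_{i-1}<w_i$) or ($i=1$ and $a_1\le -1$). A decorated labeled path is a triple $(\pi,w,dv)$ with $dv$ a set of contractible valleys (the decorated steps); $\mathsf{stLSQ}(n)^{\bullet k}$ (resp. $\mathsf{stLD}(n)^{\bullet k}$) denotes standardly labeled square (resp. Dyck) paths of size $n$ with exactly $k$ decorations. Its area is that of $\pi$. A pair $i<j$ is an attack pair if $i\notin dv$ and either ($a_i=a_j$ and $w_i<w_j$)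 or ($a_i=a_j+1$ and $w_i>w_j$); $\mathsf{dinv}(P)=\#\{\text{attack pairs}\}+\#\{i: a_i<0\}-k$. Define $S_{n,k}=\sum_{P\in\mathsf{stLSQ}(n)^{\bullet k}}(-1)^{\mathsf{dinv}(P)}t^{\mathsf{area}(P)}$. Permutations and schedule numbers. A decorated permutation is a permutation of $[n]$ some of whose letters are marked as decorated; $\mathfrak S_n^{\bullet k}$ is the set of those with exactly $k$ decorated letters. $\mathsf{revmaj}(\sigma)$ is the major index $\sum_{i:\tau_i>\tau_{i+1}} i$ of the reversed word $\tau=\sigma_n\sigma_{n-1}\cdots\sigma_1$ (decorations ignored). Write $\sigma=\rho_0\rho_1\cdots\rho_l$ as its maximal decreasing runs and let $\tilde\rho_i$ be the set of undecorated letters of $\rho_i$ ($\rho_{l+1}=\emptyset$). For a shift $s\in\{0,\dots,l\}$, the run $\rho_i$ is negative, zero, or positive if $i<s$, $i=s$, $i>s$. For a letter $c\in\rho_i$ its schedule number is: $w_{\sigma,s}(c)=\#\{d\in\tilde\rho_i:d>c\}+1$ if $i=s$ and $c$ undecorated; $w_{\sigma,s}(c)=\#\{d\in\tilde\rho_i:d>c\}+\#\{d\in\tilde\rho_{i-1}:d<c\}$ if $i>s$ and $c$ undecorated; $w_{\sigma,s}(c)=\#\{d\in\tilde\rho_i:d<c\}+\#\{d\in\tilde\rho_{i+1}:d>c\}$ if $i<s$ or $c$ is decorated. For $s>l$ all schedule numbers are set to $0$. A decorated permutation $\sigma\in\mathfrak S_n^{\bullet k}$ is an alternating dinv representative if for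 some shift $s$ one has $w_{\sigma,s}(c)=1$ for every letter $c$; $\mathsf{ADR}_{n,k}$ denotes the set of these. *)

(* Defs.v *)
From HB Require Import structures.
From mathcomp Require Import all_boot all_order all_algebra all_fingroup.

Set Implicit Arguments.
Unset Strict Implicit.
Unset Printing Implicit Defensive.

Import Order.TTheory GRing.Theory Num.Theory.

Local Open Scope ring_scope.

(* Conventions. Vertical steps, positions and letters are numbered from 0, so
   the i-th vertical step (resp. the letter i) of the literature is (i-1) here;
   labels and letters only enter through comparisons. A lattice path is the
   word of its steps, [true] for north and [false] for east. *)

Section Paths.

Variable n : nat.

Implicit Types (p : (n.*2).-tuple bool) (w : 'S_n) (dv : {set 'I_n}).

Definition square_path p : bool :=
  (count_mem true p == n) && (last true p == false).

(* Abscissas of the successive vertical steps of a path starting at abscissa x. *)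
Fixpoint vstep_cols (x : nat) (s : seq bool) : seq nat :=
  if s is b :: s' then
    if b then x :: vstep_cols x s' else vstep_cols x.+1 s'
  else [::].

Definition vcol p (i : nat) : nat := nth 0%N (vstep_cols 0 p) i.

(* The i-th vertical step starts at the point (vcol p i, i). *)
Definition area_word p (i : nat) : int := i%:Z - (vcol p i)%:Z.

Definition shift p : int :=
  - \big[Num.min/area_word p 0]_(i < n) area_word p i.

(* All summands are nonnegative, so [absz] is only a cast to [nat]. *)
Definition area p : nat := absz (\sum_(i < n) (area_word p i + shift p)).

(* Standard labelings are the permutations w, the i-th vertical step having
   label w i. *)
Definition labeling p w : bool :=
  [forall i : 'I_n, forall j : 'I_n,
    (i < j)%N && (vcol p i == vcol p j) ==> (w i < w j)%N].

Definition contractible_valley p w (i : 'I_n) : bool :=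
  [exists j : 'I_n, (j.+1 == i :> nat) &&
     ((area_word p i < area_word p j)
      || ((area_word p j == area_word p i) && (w j < w i)%N))]
  || ((i == 0%N :> nat) && (area_word p i <= -1)).

Definition attack_pair p w dv (i j : 'I_n) : bool :=
  [&& (i < j)%N, i \notin dv &
    ((area_word p i == area_word p j) && (w i < w j)%N)
    || ((area_word p i == area_word p j + 1) && (w j < w i)%N)].

Definition dinv p w dv : int :=
  #|[set ij : 'I_n * 'I_n | attack_pair p w dv ij.1 ij.2]|%:Z
  + #|[set i : 'I_n | area_word p i < 0]|%:Z - #|dv|%:Z.

Definition stLSQ (k : nat) : {set (n.*2).-tuple bool * 'S_n * {set 'I_n}} :=
  [set P : (n.*2).-tuple bool * 'S_n * {set 'I_n} |
    let: (p, w, dv) := P in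
    [&& square_path p, labeling p w,
        [forall i in dv, contractible_valley p w i] & #|dv| == k]].

Definition S_poly (k : nat) : {poly int} :=
  \sum_(P in stLSQ k)
    let: (p, w, dv) := P in ((-1 : int) ^ dinv p w dv) *: 'X^(area p).

End Paths.

Definition maj (s : seq nat) : nat :=
  (\sum_(i < (size s).-1 | nth 0 s i.+1 < nth 0 s i) i.+1)%N.

Section Permutations.

Variable n : nat.

(* A decorated permutation is a pair (sigma, D) where sigma is read as the word
   sigma 0, ..., sigma (n-1) and D is the set of its decorated letters (values,
   not positions). *)
Implicit Types (sigma : 'S_n) (D : {set 'I_n}).

Definition word sigma : seq 'I_n := [seq sigma i | i <- enum 'I_n].

Definition revmaj sigma : nat := maj (rev [seq val c | c <- word sigma]).

Fixpoint decreasing_runs (s : seq 'I_n) : seq (seq 'I_n) :=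
  if s is x :: s' then
    match decreasing_runs s' with
    | (y :: r) :: rs =>
        if (y < x)%N then (x :: y :: r) :: rs else [:: x] :: (y :: r) :: rs
    | _ => [:: [:: x]]
    end
  else [::].

Definition runs sigma : seq (seq 'I_n) := decreasing_runs (word sigma).

Definition run_index sigma (c : 'I_n) : nat :=
  find (fun r : seq 'I_n => c \in r) (runs sigma).

(* Empty when i is out of range. *)
Definition undecorated_run sigma D (i : nat) : seq 'I_n :=
  [seq d <- nth [::] (runs sigma) i | d \notin D].

Definition schedule sigma D (s : nat) (c : 'I_n) : nat :=
  let i := run_index sigma c in
  let above j := count (fun d : 'I_n => c < d)%N (undecorated_run sigma D j) in
  let below j := count (fun d : 'I_n => d < c)%N (undecorated_run sigma D j) in
  if (size (runs sigma) <= s)%N then 0%N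
  else if (i < s)%N || (c \in D) then (below i + above i.+1)%N
  else if i == s then (above i + 1)%N
  else (above i + below i.-1)%N.

(* Shifts s beyond the last run have all schedule numbers 0, so it suffices to
   let s range over the run indices. *)
Definition ADR (k : nat) : {set 'S_n * {set 'I_n}} :=
  [set x : 'S_n * {set 'I_n} | (#|x.2| == k) &&
    [exists s : 'I_(size (runs x.1)), forall c : 'I_n,
      schedule x.1 x.2 s c == 1%N]].

End Permutations.

(* Main.v *)
Require Import Defs.
From HB Require Import structures.
From mathcomp Require Import all_boot all_order all_algebra all_fingroup.
From mathcomp Require Import zify ring.

Set Implicit Arguments.
Unset Strict Implicit.
Unset Printing Implicit Defensive.

Import Order.TTheory GRing.Theory Num.Theory.

Local Open Scope ring_scope.

(** Fix the diagonal and the decoration of every label and sum over the label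
words only. Inserting the labels one at a time (undecorated nonnegative ones
first, then undecorated negative ones, then decorated ones), the signs of the
admissible positions of a label [c] alternate, so [c] contributes [0] or [1]
according to the parity of its schedule number, up to a sign [-1] for each
undecorated negative label. A nonzero total forces the level sets to be the
decreasing runs of a permutation [sigma], shifted by some [s]. If all schedule
numbers of [sigma] are odd for one shift, then each run has at most two
undecorated letters, consecutive runs interlace, all schedule numbers equal 1,
and the shifts with this property are exactly those whose zero run has a single
undecorated letter; the signs of these shifts alternate, so their sum is the
parity of the number [n - k] of undecorated letters. *)

(** * Inserting letters into words *)

(** Fixing the diagonal of every label fixes the area and the number of negative steps, so within
    such a class only the attack pairs vary. The conditions on labels and valleys, including those
    on the first and last step, then bear only on neighbours in the label word once virtual letters
    are added at both ends; this is what makes insertion possible. The insertion order meets two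
    constraints: at its turn, a letter must find all the letters that its schedule number counts,
    and its admissible gaps must carry signs that telescope. No valid word is ever constructed. When
    all schedule numbers are odd the signed sum is 1 or -1, so some word is valid, and the way this
    word crosses from level to level yields the run structure. One permutation occurs for several
    shifts with the same power of [t]; the parity of n - k arises only from the cancellation among
    these. *)

Section Insertions.

Variable T : eqType.
Implicit Types (c d : T) (x y : seq T).

Fixpoint insertions c x : seq (seq T) :=
  (c :: x) :: if x is d :: x' then [seq d :: y | y <- insertions c x'] else [::].

(** The head of the list is inserted last; [signed_count] inducts along this recursion. *)
Fixpoint arrangements x : seq (seq T) :=
  if x is c :: x' then flatten [seq insertions c y | y <- arrangements x']
  else [:: [::]].

Lemma insertions_perm c x y : y \in insertions c x -> perm_eq y (c :: x).
Proof.
elim: x y => [|d x IHx] y /=; first by rewrite inE => /eqP->.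
rewrite inE => /orP[/eqP->//|/mapP[y' /IHx p_y' ->]].
rewrite -[c :: d :: x]/([:: c] ++ d :: x) perm_sym perm_catC /= perm_cons.
by rewrite perm_sym (perm_trans p_y') // -[c :: x]/([:: c] ++ x) perm_catC.
Qed.

Lemma arrangements_perm x y : y \in arrangements x -> perm_eq y x.
Proof.
elim: x y => [|c x IHx] y /=; first by rewrite inE => /eqP->.
case/flattenP=> _ /mapP[x' /IHx p_x' ->] /insertions_perm p_y.
by rewrite (perm_trans p_y) // perm_cons.
Qed.

Lemma mem_insertions c x1 x2 : x1 ++ c :: x2 \in insertions c (x1 ++ x2).
Proof.
elim: x1 => [|d x1 IHx] /=; first by case: x2 => [|d x2]; rewrite inE eqxx.
by rewrite inE map_f ?orbT.
Qed.

Lemma mem_arrangements x y : (y \in arrangements x) = perm_eq y x.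
Proof.
apply/idP/idP; first exact: arrangements_perm.
elim: x y => [|c x IHx] y p_y; first by rewrite (perm_nilP p_y) inE.
have c_y: c \in y by rewrite (perm_mem p_y) inE eqxx.
case/splitPr: c_y p_y => y1 y2 p_y; apply/flattenP.
exists (insertions c (y1 ++ y2)); last exact: mem_insertions.
apply/map_f/IHx; rewrite -(perm_cons c); apply: perm_trans p_y.
by rewrite perm_sym -cat_cons -[c :: y2]/([:: c] ++ y2) perm_catCA.
Qed.

(** Deleting [c] recovers the word, so insertions into distinct words never coincide. *)
Lemma filter_insertions c x y :
  c \notin x -> y \in insertions c x -> [seq d <- y | d != c] = x.
Proof.
move=> c_x; have fx: [seq d <- x | d != c] = x.
  by apply/all_filterP/allP=> d x_d; apply: contraNneq c_x => <-.
elim: x y c_x fx => [|d x IHx] y; rewrite /= ?inE.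
  by move=> _ _ /eqP->; rewrite /= eqxx.
rewrite negb_or eq_sym => /andP[dc c_x]; rewrite dc => -[fx].
by case/orP=> [/eqP->|/mapP[y' /IHx y'P ->]]; rewrite /= ?eqxx /= dc ?fx ?y'P.
Qed.

Lemma uniq_insertions c x : c \notin x -> uniq (insertions c x).
Proof.
elim: x => [|d x IHx] //=; rewrite inE negb_or => /andP[c_d c_x].
rewrite map_inj_uniq ?IHx ?andbT // => [|y1 y2 [] //].
by apply/mapP=> -[y _ [] /eqP]; rewrite (negPf c_d).
Qed.

Lemma uniq_arrangements x : uniq x -> uniq (arrangements x).
Proof.
elim: x => [|c x IHx] //= /andP[c_x /IHx].
have: all (fun y => c \notin y) (arrangements x).
  by apply/allP=> y /arrangements_perm/perm_mem->.
elim: (arrangements x) => //= y s IHs /andP[c_y c_s] /andP[y_s u_s].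
rewrite cat_uniq uniq_insertions //= IHs // andbT.
apply/hasPn=> z /flattenP[_ /mapP[y' s_y' ->] z_y'].
apply: contra y_s => z_y; rewrite -(filter_insertions c_y z_y).
by rewrite (filter_insertions (allP c_s _ s_y') z_y').
Qed.

Lemma perm_arrangements x y :
  uniq x -> perm_eq x y -> perm_eq (arrangements x) (arrangements y).
Proof.
move=> u_x p_xy; apply: uniq_perm; rewrite ?uniq_arrangements -?(perm_uniq p_xy) //.
by move=> z; rewrite !mem_arrangements; apply: (permPr p_xy).
Qed.

End Insertions.

(** * Signed sum over the insertions of one letter *)

Section SignedCount.

Variables (att R : rel nat).

Fixpoint attacks (x : seq nat) : nat :=
  if x is d :: x' then (count (att d) x' + attacks x')%N else 0%N.

(** Inadmissible words get weight 0, so sums may range over all arrangements. The preceding letter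
    [e] is a parameter for the sake of induction on [x]. *)
Definition signed_term (e : nat) (x : seq nat) : int :=
  (path R e (rcons x 1%N))%:R * (-1) ^+ attacks x.

Variable c : nat.

Let both d := R d c && R c d.

(* The letters that may follow or precede [c] form alternating blocks, so the
   signs of the admissible gaps telescope. *)
Lemma sum_insertions e x :
  {in x, forall d, R d c || R c d} ->
  {in x, forall d, att d c (+) att c d = both d} ->
  {in e :: x & rcons x 1%N, forall d f, R d f -> R d c || R c f} ->
  {in e :: x & rcons x 1%N, forall d f, R d c -> R c f -> R d f} ->
  \sum_(y <- insertions c x) signed_term e y =
  signed_term e x * (-1) ^+ count (att c) x *
    ((R e c)%:R - (odd (count both x))%:R
     - (-1) ^+ count both x * (~~ R c 1%N)%:R).
Proof.
(* By [hT], removing [c] from an admissible word leaves an admissible one; with [hQ], the gap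
   between neighbours d, f of an admissible word has indicator [R d c] + [R c f] - 1. By [hA] each
   letter may stand on at least one side of [c], and by [hS] moving [c] past it flips the sign
   exactly when it may stand on both. *)
rewrite /signed_term; elim: x e => [|f x IHx] e hA hS hQ hT.
  rewrite /= big_seq1 /= !andbT !expr0.
  have h1 : R e c && R c 1%N ==> R e 1%N.
    by apply/implyP=> /andP[]; apply: hT; rewrite ?inE ?eqxx.
  have h2 : R e 1%N ==> R e c || R c 1%N.
    by apply/implyP; apply: hQ; rewrite ?inE ?eqxx.
  by move: h1 h2; case: (R e c) (R c 1%N) (R e 1%N) => [] [] [] //= _ _; ring.
rewrite [insertions _ _]/= big_cons big_map /=.
have sub1 d : d \in f :: x -> d \in e :: f :: x by move=> fd; rewrite inE fd orbT.
have sub2 d : d \in rcons x 1%N -> d \in f :: rcons x 1%N by move=> fd; rewrite inE fd orbT.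
have att_ins y : y \in insertions c x ->
    count (att f) y = (att f c + count (att f) x)%N.
  by move/insertions_perm/seq.permP->.
under eq_big_seq => y y_ins.
  rewrite (att_ins y y_ins) -mulnb natrM !exprD.
  rewrite (_ : _ * _ = (R e f)%:R * (-1) ^+ att f c * (-1) ^+ count (att f) x *
     ((path R f (rcons y 1%N))%:R * (-1) ^+ attacks y)); last by ring.
  over.
rewrite -mulr_sumr IHx; first last.
- by move=> d g xd xg; apply: hT; [apply: sub1 | apply: sub2].
- by move=> d g xd xg; apply: hQ; [apply: sub1 | apply: sub2].
- by move=> d xd; apply: hS; rewrite inE xd orbT.
- by move=> d xd; apply: hA; rewrite inE xd orbT.
have h1 : R e c && R c f ==> R e f.
  by apply/implyP=> /andP[]; apply: hT; rewrite ?inE ?eqxx ?orbT.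
have h2 : R e f ==> R e c || R c f.
  by apply/implyP; apply: hQ; rewrite ?inE ?eqxx ?orbT.
have := hA f; have := hS f; rewrite mem_head /both => /(_ isT) h3 /(_ isT) h4.
rewrite -!mulnb !natrM !exprD oddD.
move: ((-1) ^+ attacks x) ((-1) ^+ count (att f) x) ((-1) ^+ count (att c) x) => a b g.
(* Expressing the sign through the parity leaves a finite check on the relations between [e], [c]
   and [f]. *)
have: (-1) ^+ count (fun d => R d c && R c d) x =
    1 - (odd (count (fun d => R d c && R c d) x))%:R *+ 2 :> int.
  by rewrite -signr_odd; case: odd.
move: ((-1) ^+ count _ x) (odd (count _ x)) => m o ->.
move: ((path R f (rcons x 1%N))%:R) ((~~ R c 1%N)%:R) => p q.
by move: h1 h2 h3 h4; case: (R e c) (R c f) (R e f) (R f c) (att f c) (att c f)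
  => [] [] [] [] [] [] //= _ _ _ _; case: o => /=; ring.
Qed.

End SignedCount.

(** * Admissible label words with prescribed levels *)

Section Levels.

(* Letters are shifted by 2: the letter 0 stands for a virtual step before the
   path, on diagonal -1, and the letter 1 for a virtual step after it, on the
   main diagonal. Levels are diagonals shifted by [z]. *)
Variables (z : nat) (lv : nat -> nat) (dec : pred nat).
Hypotheses (z_gt0 : (0 < z)%N) (lv0 : lv 0%N = z.-1) (lv1 : lv 1%N = z).
Hypothesis dec1 : dec 1%N = false.

(** A rise by one level stays in the same column, so labels increase and [f] is no valley; a drop is
    always allowed; on an equal level, [f] is a contractible valley only if the label grows. Applied
    to the virtual letters, the same rule puts a decorated first step below level [z] and the last
    step at level [z] or above. *)
Definition follows (e f : nat) : bool :=
  [|| (lv f == (lv e).+1) && (e < f)%N && ~~ dec f,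
      (lv f < lv e)%N | (lv f == lv e) && (dec f ==> (e < f)%N)].

Definition attack (d c : nat) : bool :=
  ~~ dec d && ((lv d == lv c) && (d < c)%N || (lv d == (lv c).+1) && (c < d)%N).

Definition scheduled (c d : nat) : bool :=
  ~~ dec d &&
  if (lv c < z)%N || dec c
  then (lv d == lv c) && (d < c)%N || (lv d == (lv c).+1) && (c < d)%N
  else (lv d == lv c) && (c < d)%N
       || [&& lv c == (lv d).+1, (z <= lv d)%N & (d < c)%N].

Definition schedule_number (U : seq nat) (c : nat) : nat :=
  (count (scheduled c) U + [&& lv c == z & ~~ dec c])%N.

(** Nonnegative levels are filled upwards, each from its largest letter; negative ones downwards,
    each from its smallest letter; decorated letters come in any order. Each letter then comes after
    all those that its schedule number counts. *)
Definition inserted_before (d c : nat) : bool :=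
  if dec d || dec c then dec c else
  if (z <= lv d)%N
  then [|| (lv c < z)%N, (lv d < lv c)%N | (lv d == lv c) && (c <= d)%N]
  else (lv c < z)%N && ((lv c < lv d)%N || (lv d == lv c) && (d <= c)%N).

Lemma inserted_before_total : total inserted_before.
Proof.
move=> d c; rewrite /inserted_before.
by case: (dec d) (dec c) (leqP z (lv d)) (leqP z (lv c)) => [] [] [] ? [] ? /=; lia.
Qed.

Lemma inserted_before_trans : transitive inserted_before.
Proof.
move=> b a c; rewrite /inserted_before.
by case: (dec a) (dec b) (dec c) (leqP z (lv a)) (leqP z (lv b)) (leqP z (lv c))
  => [] [] [] [] ? [] ? [] ? /=; lia.
Qed.

Lemma follows_undecorated d c : ~~ dec c ->
  follows d c = (lv c <= lv d)%N || (lv c == (lv d).+1) && (d < c)%N.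
Proof. by rewrite /follows => /negPf->; rewrite /=; lia. Qed.

Lemma follows_decorated d c : dec c ->
  follows d c = (lv c < lv d)%N || (lv c == lv d) && (d < c)%N.
Proof. by rewrite /follows => ->; rewrite /=; lia. Qed.

Section Insertion.

Variables (c : nat) (x : seq nat).
Hypotheses (c_gt1 : (1 < c)%N) (x_gt1 : {in x, forall d, (1 < d)%N}).
Hypotheses (c_x : c \notin x) (x_bef : {in x, forall d, inserted_before d c}).

Let x_neq d : d \in x -> d != c.
Proof. by move=> xd; apply: contraNneq c_x => <-. Qed.

Let insertion_factor : int :=
  (-1) ^+ count (attack c) x *
    ((follows 0 c)%:R - (odd (count (fun d => follows d c && follows c d) x))%:R
     - (-1) ^+ count (fun d => follows d c && follows c d) x
       * (~~ follows c 1%N)%:R).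

Let insertion_sum :=
  \sum_(y <- insertions c x) signed_term attack follows 0 y
    = signed_term attack follows 0 x * insertion_factor.

(** Here [c] may precede every letter present and the final virtual letter, and it attacks exactly
    the b letters it counts. The factor (-1)^b ([lv c = z] - odd b) is the parity of b +
    [lv c = z]. *)
Lemma insert_nonneg : ~~ dec c -> (z <= lv c)%N ->
  insertion_sum /\ insertion_factor = (odd (schedule_number x c))%:R.
Proof.
move=> c0 zc; have cz: (lv c < z)%N = false by rewrite ltnNge zc.
have xP d : d \in x -> [/\ ~~ dec d, (z <= lv d <= lv c)%N, (1 < d)%N
    & (lv d < lv c)%N || (c < d)%N].
  move=> xd; have := x_bef xd; have := x_neq xd; have := x_gt1 xd.
  by rewrite /inserted_before (negPf c0) orbF; case: (dec d) => //=;
    case: (leqP z (lv d)) => //= ? ? ? ?; split=> //; clear c_x; lia.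
have xP1 d : d \in 0%N :: x -> follows d c =
    (lv d == lv c) || (lv c == (lv d).+1) && (d < c)%N.
  rewrite inE follows_undecorated // => /orP[/eqP->|/xP[_ h _ _]].
    by rewrite lv0; clear -zc z_gt0; lia.
  clear -h; lia.
have xP2 f : f \in rcons x 1%N -> follows c f.
  rewrite mem_rcons inE => /orP[/eqP->|/xP[f0 ? _ _]]; rewrite follows_undecorated ?dec1 //; lia.
split.
  rewrite /insertion_sum /insertion_factor mulrA.
  apply: sum_insertions => [d xd|d xd|d f xd xf|d f xd xf].
  - by rewrite orbC xP2 // mem_rcons inE xd orbT.
  - rewrite xP1 ?xP2 ?mem_rcons ?inE ?xd ?orbT // /attack (negPf c0).
    have [/negPf-> h1 _ h2] := xP d xd; clear -h1 h2; lia.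
  - by rewrite (xP2 f) ?orbT.
  - rewrite xP1 // => + _; rewrite follows_undecorated; last first.
      by move: xf; rewrite mem_rcons inE => /orP[/eqP->|/xP[]//]; rewrite dec1.
    move: xf xd; rewrite mem_rcons !inE => /orP[/eqP->|/xP[_ f1 f3 f2]].
      rewrite lv1 => /orP[/eqP->|/xP[_ d1 _ d2]]; first by rewrite lv0; clear -z_gt0; lia.
      by clear -d1 d2; lia.
    case/orP=> [/eqP->|/xP[_ d1 _ d2]]; first by rewrite lv0; clear -f1 f3 z_gt0; lia.
    by clear -f1 f2 d1 d2; lia.
have bothE : {in x, (fun d => follows d c && follows c d) =1 scheduled c}.
  move=> d xd; rewrite xP1 ?xP2 ?mem_rcons ?inE ?xd ?orbT //.
  rewrite /scheduled (negPf c0) cz /=.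
  by have [-> /= h1 _ h2] := xP d xd; clear -h1 h2; lia.
have attE : {in x, attack c =1 scheduled c}.
  move=> d xd; rewrite /attack /scheduled c0 cz (negPf c0) /=.
  by have [-> /= h1 _ h2] := xP d xd; clear -h1 h2; lia.
rewrite /insertion_factor (eq_in_count bothE) (eq_in_count attE) xP2 ?mem_rcons ?mem_head //.
rewrite xP1 ?mem_head // lv0 prednK // /schedule_number c0 andbT.
rewrite (_ : (_ == lv c) || _ = (lv c == z)); last by clear -zc z_gt0 c_gt1; lia.
rewrite oddD -signr_odd; case: (odd _); case: (lv c == z) => //=; ring.
Qed.

(** Mirror case: every letter present may precede [c], which attacks none of them and cannot end the
    word. The factor is 1 - odd b - (-1)^b = odd b. *)
Lemma insert_neg : ~~ dec c -> (lv c < z)%N ->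
  insertion_sum /\ insertion_factor = (odd (schedule_number x c))%:R.
Proof.
move=> c0 zc.
have xP d : d \in x -> [/\ ~~ dec d, (lv c <= lv d)%N, (1 < d)%N
    & (lv c < lv d)%N || (d < c)%N].
  move=> xd; have := x_bef xd; have := x_neq xd; have := x_gt1 xd.
  by rewrite /inserted_before (negPf c0) orbF; case: (dec d) => //=;
    case: (leqP z (lv d)) => //= ? ? ? ?; split=> //; clear c_x; lia.
have xP1 d : d \in 0%N :: x -> follows d c.
  rewrite inE follows_undecorated // => /orP[/eqP->|/xP[_ -> //]].
  by rewrite lv0; clear -zc z_gt0; lia.
have xP2 f : f \in rcons x 1%N -> follows c f =
    (lv f == lv c) || (lv f == (lv c).+1) && (c < f)%N.
  rewrite mem_rcons inE => /orP[/eqP->|/xP[f0 h _ _]].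
    by rewrite follows_undecorated ?dec1 // lv1; clear -zc z_gt0; lia.
  by rewrite follows_undecorated //; clear -h; lia.
split.
  rewrite /insertion_sum /insertion_factor mulrA.
  apply: sum_insertions => [d xd|d xd|d f xd xf|d f xd xf].
  - by rewrite xP1 // inE xd orbT.
  - rewrite xP1 ?xP2 ?mem_rcons ?inE ?xd ?orbT // /attack (negPf c0) /=.
    by have [/negPf-> h1 _ h2] := xP d xd; clear -h1 h2; lia.
  - by rewrite (xP1 d).
  - rewrite xP2 // => _; rewrite follows_undecorated; last first.
      by move: xf; rewrite mem_rcons inE => /orP[/eqP->|/xP[]//]; rewrite dec1.
    move: xf xd; rewrite mem_rcons !inE => /orP[/eqP->|/xP[_ f1 f3 f2]].
      by rewrite lv1 => _; clear -zc c_gt1; lia.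
    case/orP=> [/eqP->|/xP[_ d1 _ d2]]; first by rewrite lv0; clear -f1 f3 z_gt0 zc; lia.
    by clear -f1 f2 d1 d2; lia.
have bothE : {in x, (fun d => follows d c && follows c d) =1 scheduled c}.
  move=> d xd; rewrite xP1 ?xP2 ?mem_rcons ?inE ?xd ?orbT // /scheduled zc /=.
  by have [-> /= _ _ h] := xP d xd; clear -h; lia.
have attE : {in x, attack c =1 pred0}.
  move=> d xd; rewrite /attack c0 /=.
  by have [_ h1 _ h2] := xP d xd; clear -h1 h2; lia.
rewrite /insertion_factor (eq_in_count bothE) (eq_in_count attE) count_pred0.
rewrite xP1 ?mem_head // xP2 ?mem_rcons ?mem_head // lv1 /schedule_number c0.
rewrite (_ : ~~ _ = true); last by clear -zc c_gt1; lia.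
rewrite (_ : (lv c == z) = false) ?addn0; last by clear -zc; lia.
by rewrite expr0 -signr_odd; case: (odd _) => /=; ring.
Qed.

(** A decorated letter attacks nothing. It may begin the word exactly when it may not end it, namely
    below level [z]; so the factor is odd b there and -odd b elsewhere. *)
Lemma insert_decorated : dec c ->
  insertion_sum /\
  insertion_factor = (-1) ^+ (z <= lv c)%N * (odd (schedule_number x c))%:R.
Proof.
move=> c1.
have attE d : attack c d = false by rewrite /attack c1.
have c_d d : follows d c = (lv c < lv d)%N || (lv c == lv d) && (d < c)%N.
  exact: follows_decorated.
split.
  rewrite /insertion_sum /insertion_factor mulrA.
  apply: sum_insertions => [d xd|d xd|d f xd xf|d f xd xf].
  - have := x_neq xd; have := x_gt1 xd; rewrite c_d /follows; case: (dec d) => /=;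
    clear; lia.
  - rewrite c_d attE addbF /attack /follows; case: (dec d) => /=.
      by have := x_neq xd; clear; lia.
    by have := x_neq xd; clear; lia.
  - have f_c : f != c.
      move: xf; rewrite mem_rcons inE => /orP[/eqP->|/x_neq//].
      by clear -c_gt1; lia.
    have d_c : d != c.
      by move: xd; rewrite inE => /orP[/eqP->|/x_neq//]; clear -c_gt1; lia.
    by rewrite c_d /follows; case: (dec f) => /=; move: f_c d_c; clear; lia.
  - by rewrite c_d /follows; case: (dec f) => /=; clear; lia.
have bothE : {in x, (fun d => follows d c && follows c d) =1 scheduled c}.
  move=> d xd; rewrite c_d /scheduled c1 orbT /follows.
  by have := x_neq xd; case: (dec d) => /=; clear; lia.
rewrite /insertion_factor (eq_in_count bothE) (eq_count attE) count_pred0.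
rewrite c_d lv0 /schedule_number c1 andbF addn0.
rewrite (_ : (_ < _)%N || _ = (lv c < z)%N); last by clear -z_gt0 c_gt1; lia.
rewrite follows_undecorated ?dec1 // lv1.
rewrite (_ : ~~ _ = (lv c < z)%N); last by clear -c_gt1; lia.
rewrite expr0 -signr_odd (leqNgt z).
by case: (odd _); case: (lv c < z)%N => /=; ring.
Qed.

(** The prefactor is the share of [c] in the remaining terms of [dinv]; it cancels the sign of
    [insert_decorated] and leaves one for undecorated negative letters only. *)
Lemma insert_letter :
  (-1) ^+ ((lv c < z)%N + dec c) *
    (\sum_(y <- insertions c x) signed_term attack follows 0 y) =
  signed_term attack follows 0 x *
    ((-1) ^+ ((lv c < z)%N && ~~ dec c) * (odd (schedule_number x c))%:R).
Proof.
case: (boolP (dec c)) => c0.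
  have [-> ->] := insert_decorated c0; rewrite (leqNgt z) andbF.
  by case: (lv c < z)%N => /=; ring.
rewrite addn0 andbT; case: (ltnP (lv c) z) => zc.
  by have [-> ->] := insert_neg c0 zc; rewrite mulrCA.
by have [-> ->] := insert_nonneg c0 zc; rewrite mulrCA.
Qed.

End Insertion.

Lemma scheduled_irrefl c : scheduled c c = false.
Proof. by rewrite /scheduled !ltnn !andbF /=; case: ifP; case: (dec c). Qed.

(** Later insertions do not change the schedule number of a letter already present. *)
Lemma scheduled_before d c :
  inserted_before d c -> d != c -> scheduled d c = false.
Proof.
rewrite /inserted_before /scheduled.
case: (dec c) => //=; case: (dec d) => //=.
by case: (leqP z (lv d)) => /=; clear; lia.
Qed.

Lemma signed_count U : uniq U -> {in U, forall c, (1 < c)%N} ->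
  \sum_(x <- arrangements U)
    (-1) ^+ (\sum_(c <- U) ((lv c < z)%N + dec c)) * signed_term attack follows 0 x
  = (-1) ^+ count (fun c => (lv c < z)%N && ~~ dec c) U
    * (all (fun c => odd (schedule_number U c)) U)%:R.
Proof.
(* Reversed, because [arrangements] inserts the head last. *)
set bef := fun a b => inserted_before b a.
have tot: total bef by move=> a b; apply: inserted_before_total.
have tr: transitive bef by move=> b a c h1 h2; apply: inserted_before_trans h2 h1.
wlog: U / sorted bef U => [IH uU U_gt1|].
  have pU: perm_eq (sort bef U) U by rewrite perm_sort.
  have sU_gt1: {in sort bef U, forall c, (1 < c)%N}.
    by move=> c; rewrite mem_sort; apply: U_gt1.
  have := IH _ (sort_sorted tot U) _ sU_gt1; rewrite sort_uniq uU => /(_ isT).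
  rewrite (perm_big _ (perm_arrangements _ pU)) ?sort_uniq //=.
  under eq_bigr => x _ do rewrite (perm_big _ pU).
  rewrite (seq.permP pU) (perm_all _ pU) => ->; congr (_ * (nat_of_bool _)%:R).
  by apply: eq_all => c; rewrite /schedule_number (seq.permP pU).
elim: U => [|c U IHU]; rewrite ?big_nil.
  by rewrite /= big_seq1 /signed_term /= /follows lv0 lv1 dec1 prednK // eqxx.
rewrite /= (path_sortedE tr) => /andP[/allP c_bef sU] /andP[c_U uU] U_gt1.
have {}IHU := IHU sU uU (fun d Ud => U_gt1 d (@mem_behead _ (c :: U) d Ud)).
have U_neq d : d \in U -> d != c by move=> Ud; apply: contraNneq c_U => <-.
rewrite (eq_in_all (a2 := fun d => odd (schedule_number U d))); last first.
  move=> d Ud; rewrite /schedule_number /= scheduled_before ?U_neq //.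
  exact: c_bef.
rewrite [schedule_number (c :: U) c]/schedule_number /= scheduled_irrefl add0n.
rewrite -/(schedule_number U c).
rewrite (_ : (_ && _)%:R = (odd (schedule_number U c))%:R
   * (all (fun d => odd (schedule_number U d)) U)%:R :> int); last first.
  by rewrite -natrM mulnb.
rewrite exprD mulrACA -IHU mulr_sumr big_flatten big_map big_cons.
apply: eq_big_seq => x /arrangements_perm p_x.
rewrite exprD -mulr_sumr [LHS]mulrAC insert_letter.
- by rewrite /schedule_number (seq.permP p_x); ring.
- by apply: U_gt1; rewrite mem_head.
- by move=> d xd; apply: U_gt1; rewrite inE -(perm_mem p_x) xd orbT.
- by rewrite (perm_mem p_x).
- by move=> d; rewrite (perm_mem p_x) => /c_bef.
Qed.

(** Levels rise by at most one at a time, and only along increasing letters; the first step that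
    leaves the levels up to [j] is such a rise. *)
Lemma crossing j e x : path follows e x -> (lv e <= j)%N ->
  has (fun f => (j < lv f)%N) x ->
  exists d f, [/\ d \in e :: x, f \in x, (d < f)%N, lv d = j & lv f = j.+1].
Proof.
clear z_gt0 lv0 lv1 dec1; elim: x e => //= f x IHx e /andP[ef fx] ej.
case: (ltnP j (lv f)) => [jf _|fj /= jx].
  by exists e, f; rewrite !mem_head; move: ef; rewrite /follows; split=> //; lia.
have [d [g [fd xg dg dj gj]]] := IHx f fx fj jx.
by exists d, g; split=> //; rewrite inE ?fd ?xg orbT.
Qed.

End Levels.

(** * Lattice paths as words of levels *)

(** Inverse of [vstep_cols] on weakly increasing columns; the final abscissa [m] restores the
    trailing east steps, which [vstep_cols] forgets. *)
Fixpoint word_of_cols (m x : nat) (C : seq nat) : seq bool :=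
  if C is c :: C' then nseq (c - x) false ++ true :: word_of_cols m c C'
  else nseq (m - x) false.

Lemma vstep_cols_nseq x k s :
  vstep_cols x (nseq k false ++ s) = vstep_cols (x + k) s.
Proof. by elim: k x => [|k IHk] x /=; rewrite ?addn0 // IHk addSnnS. Qed.

Lemma size_vstep_cols x s : size (vstep_cols x s) = count_mem true s.
Proof. by elim: s x => //= -[] s IHs x; rewrite /= IHs. Qed.

Lemma vstep_cols_sorted x s : path leq x (vstep_cols x s).
Proof.
elim: s x => //= -[] s IHs x /=; rewrite ?leqnn ?IHs //.
by have := IHs x.+1; case: vstep_cols => //= c C /andP[/ltnW-> ->].
Qed.

Lemma word_of_colsK m x C :
  path leq x C -> vstep_cols x (word_of_cols m x C) = C.
Proof.
elim: C x => [|c C IHC] x /=.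
  by move=> _; rewrite -[nseq _ _]cats0 vstep_cols_nseq.
by move=> /andP[xc cC]; rewrite vstep_cols_nseq /= subnKC // IHC.
Qed.

Lemma word_of_colsS m x C : path leq x.+1 C -> (x < m)%N ->
  word_of_cols m x C = false :: word_of_cols m x.+1 C.
Proof.
case: C => [_|c C /= /andP[xc _] _] /=; first by move/subnSK <-.
by rewrite -(subnSK xc).
Qed.

Lemma vstep_colsK x s :
  word_of_cols (x + count_mem false s) x (vstep_cols x s) = s.
Proof.
elim: s x => [|b s IHs] x /=; first by rewrite addn0 subnn.
case: b => /=; first by rewrite add0n subnn /= IHs.
rewrite word_of_colsS ?vstep_cols_sorted //; last by lia.
by rewrite -{3}(IHs x.+1) addnA addn1.
Qed.

Lemma leq_path_last x C : path leq x C -> (x <= last x C)%N.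
Proof. by elim: C x => //= c C IHC x /andP[/leq_trans xc /IHC]; apply: xc. Qed.

Lemma size_word_of_cols m x C : path leq x C -> (last x C <= m)%N ->
  size (word_of_cols m x C) = (size C + (m - x))%N.
Proof.
elim: C x => [|c C IHC] x /=; first by rewrite size_nseq.
move=> /andP[xc cC] Cm; rewrite size_cat size_nseq /= IHC //.
have: (c <= m)%N by apply: leq_trans Cm; apply: leq_path_last.
by lia.
Qed.

Lemma last_word_of_cols m x C : (last x C < m)%N ->
  last true (word_of_cols m x C) = false.
Proof.
elim: C x => [|c C IHC] x /= Cm; last by rewrite last_cat /= IHC.
by rewrite -(subnSK Cm) /=; elim: (_ - _)%N.
Qed.

Lemma last_vstep_cols x s : (0 < size s)%N -> last true s = false ->
  (last x (vstep_cols x s) < x + count_mem false s)%N.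
Proof.
elim: s x => // b s IHs x _; case: s IHs => [_|b' s IHs].
  by case: b => //= _; rewrite addn1.
move: (b' :: s) (isT : 0 < size (b' :: s))%N IHs => s' s'_gt0 IHs.
case: b => /= s'_last; first exact: IHs.
have: last true s' = false by case: s' s'_gt0 s'_last {IHs}.
move/(IHs x.+1 s'_gt0); case: (vstep_cols x.+1 s') => [|c C] /=; lia.
Qed.

(** * Bijection between decorated labeled paths and valid label words *)

Section Encoding.

Variable n : nat.
Hypothesis n_gt0 : (0 < n)%N.

Implicit Types (p : (n.*2).-tuple bool) (w : 'S_n) (dv D : {set 'I_n}).
Implicit Types (l : {ffun 'I_n -> 'I_n.*2}).

Definition letter (c : 'I_n) : nat := c.+2.
Arguments letter : simpl never.

Definition letters : seq nat := [seq letter c | c <- enum 'I_n].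

Definition label_word w : seq nat := [seq letter (w i) | i <- enum 'I_n].

(** Diagonals are raised by [n] to become natural numbers, so the main diagonal is level [n]. *)
Definition level_fun l (m : nat) : nat :=
  match m with
  | 0 => n.-1
  | 1 => n
  | m'.+2 => oapp (fun c : 'I_n => l c : nat) 0%N (insub m')
  end.

Definition dec_fun D (m : nat) : bool :=
  if m is m'.+2 then oapp (fun c : 'I_n => c \in D) false (insub m') else false.

Lemma level_letter l c : level_fun l (letter c) = l c.
Proof. by rewrite /level_fun /letter /= valK. Qed.

Lemma dec_letter D c : dec_fun D (letter c) = (c \in D).
Proof. by rewrite /dec_fun /letter /= valK. Qed.

Lemma uniq_letters : uniq letters.
Proof. by rewrite map_inj_uniq ?enum_uniq // => c d [] /val_inj. Qed.

Lemma letters_gt1 : {in letters, forall c, (1 < c)%N}.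
Proof. by move=> _ /mapP[c _ ->]. Qed.

Lemma size_label_word w : size (label_word w) = n.
Proof. by rewrite size_map size_enum_ord. Qed.

Lemma nth_label_word w (i : 'I_n) : nth 0%N (label_word w) i = letter (w i).
Proof. by rewrite (nth_map i) ?size_enum_ord // nth_ord_enum. Qed.

Lemma label_word_inj : injective label_word.
Proof.
move=> w1 w2 e12; apply/permP=> i.
by have := nth_label_word w1 i; rewrite e12 nth_label_word => -[] /val_inj.
Qed.

Lemma sum_arrangements_letters (F : seq nat -> int) :
  \sum_(x <- arrangements letters) F x = \sum_w F (label_word w).
Proof.
rewrite -big_enum -(big_map label_word xpredT F); apply: perm_big.
apply: uniq_perm; first exact: uniq_arrangements uniq_letters.
  by rewrite map_inj_uniq ?enum_uniq //; apply: label_word_inj.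
move=> x; rewrite mem_arrangements; apply/idP/mapP=> [x_perm|[w _ ->]].
  have: perm_eq x (tval [tuple letter i | i < n]) by [].
  case/tuple_permP=> w ->; exists w; rewrite ?mem_enum //.
  by apply: eq_map => i /=; rewrite tnth_mktuple.
change (perm_eq (label_word w) (tval [tuple letter i | i < n])).
by apply/tuple_permP; exists w; apply: eq_map => i; rewrite tnth_mktuple.
Qed.

Definition valid_word l w D : bool :=
  path (follows (level_fun l) (dec_fun D)) 0%N (rcons (label_word w) 1%N).

Lemma valid_wordP l w D : reflect
  [/\ forall i : 'I_n, i = 0%N :> nat ->
        follows (level_fun l) (dec_fun D) 0%N (letter (w i)),
      forall i j : 'I_n, i.+1 = j ->
        follows (level_fun l) (dec_fun D) (letter (w i)) (letter (w j))
    & forall i : 'I_n, i.+1 = n ->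
        follows (level_fun l) (dec_fun D) (letter (w i)) 1%N]
  (valid_word l w D).
Proof.
have nthE (i : 'I_n) : nth 0%N (rcons (label_word w) 1%N) i = letter (w i).
  by rewrite nth_rcons size_label_word ltn_ord nth_label_word.
have nthSE (i : 'I_n) : nth 0%N (0%N :: rcons (label_word w) 1%N) i.+1 = letter (w i).
  exact: nthE.
have nth_n : nth 0%N (rcons (label_word w) 1%N) n = 1%N.
  by rewrite nth_rcons size_label_word ltnn eqxx.
apply: (iffP (pathP 0%N)); rewrite size_rcons size_label_word.
  move=> h; split=> [i i0|i j ij|i i_n].
  - by have := h i (ltnW (ltn_ord i)); rewrite nthE i0.
  - by have := h j (ltnW (ltn_ord j)); rewrite nthE -ij nthSE.
  - by have := h i.+1; rewrite nthSE i_n nth_n => /(_ (leqnn _)).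
move=> [h0 h1 h2] [_|i].
  by have := h0 (Ordinal n_gt0) erefl; rewrite -nthE.
rewrite ltnS => lt_in; have := nthSE (Ordinal lt_in) => /= ->.
have [lt_in'|i_n] : (i.+1 < n)%N \/ i.+1 = n by lia.
  by have := nthE (Ordinal lt_in') => /= ->; apply: h1.
by rewrite i_n nth_n; apply: h2.
Qed.

Lemma level_lt p (i : 'I_n) : (n + i - vcol p i < n.*2)%N.
Proof. by have := ltn_ord i; clear; lia. Qed.

Definition levels_of p w : {ffun 'I_n -> 'I_n.*2} :=
  [ffun c => Ordinal (level_lt p ((w^-1)%g c))].

Definition encode (P : (n.*2).-tuple bool * 'S_n * {set 'I_n}) :=
  let: (p, w, dv) := P in (levels_of p w, w, [set c | (w^-1)%g c \in dv]).

Definition cols_of l w : seq nat := [seq (n + i - l (w i))%N | i : 'I_n <- enum 'I_n].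

(** The default of [insubd] is not reached on valid words, by [val_decode]. *)
Definition decode (Q : {ffun 'I_n -> 'I_n.*2} * 'S_n * {set 'I_n}) :=
  let: (l, w, D) := Q in
  (insubd (nseq_tuple n.*2 false) (word_of_cols n 0 (cols_of l w)), w,
   [set i | w i \in D]).

Lemma levels_ofE p w (i : 'I_n) : levels_of p w (w i) = (n + i - vcol p i)%N :> nat.
Proof. by rewrite ffunE /= permK. Qed.


Lemma square_path_false p : square_path p -> count_mem false p = n.
Proof.
case/andP=> /eqP p_n _; have := count_predC (pred1 true) p.
rewrite size_tuple p_n (eq_count (a2 := pred1 false)) => [|[]//].
by lia.
Qed.

Lemma size_cols p : square_path p -> size (vstep_cols 0 p) = n.
Proof. by case/andP=> /eqP p_n _; rewrite size_vstep_cols. Qed.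

Lemma vcol_mono p (i j : nat) :
  square_path p -> (i <= j < n)%N -> (vcol p i <= vcol p j)%N.
Proof.
move=> p_sq /andP[le_ij lt_jn].
apply: (sorted_leq_nth leq_trans leqnn); rewrite ?inE ?size_cols //.
- exact: path_sorted (vstep_cols_sorted 0 p).
- exact: leq_ltn_trans lt_jn.
Qed.

Lemma vcol_lt p i : square_path p -> (i < n)%N -> (vcol p i < n)%N.
Proof.
move=> p_sq lt_in; apply: (@leq_ltn_trans (vcol p n.-1)).
  by apply: vcol_mono => //; lia.
have := @last_vstep_cols 0 p; rewrite size_tuple double_gt0 n_gt0 => /(_ isT).
case/andP: (p_sq) => _ /eqP-> /(_ erefl).
rewrite square_path_false // add0n (last_nth 0%N) size_cols //.
by rewrite -[X in nth _ _ X](prednK n_gt0).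
Qed.

Lemma nth_cols_of l w (i : 'I_n) : nth 0%N (cols_of l w) i = (n + i - l (w i))%N.
Proof. by rewrite (nth_map i) ?size_enum_ord // nth_ord_enum. Qed.

Lemma level_le_step (f : nat -> nat) (D' : pred nat) e c :
  follows f D' e c -> (f c <= (f e).+1)%N.
Proof. by rewrite /follows; case: (D' c); lia. Qed.

(** Ensures that the subtraction in [cols_of] does not truncate. *)
Lemma valid_level_le l w D (i : 'I_n) : valid_word l w D -> (l (w i) <= n + i)%N.
Proof.
case/valid_wordP=> h0 h1 _; case: i => i; elim: i => [|i IHi] lt_in.
  have := level_le_step (h0 (Ordinal lt_in) erefl); rewrite level_letter /=; lia.
have := level_le_step (h1 (Ordinal (ltnW lt_in)) (Ordinal lt_in) erefl).
have := IHi (ltnW lt_in); rewrite !level_letter /=; lia.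
Qed.

Lemma cols_of_sorted l w D : valid_word l w D -> path leq 0%N (cols_of l w).
Proof.
move=> v; apply/(pathP 0%N)=> i; rewrite size_map size_enum_ord => lt_in.
case: i lt_in => [//|i] lt_in /=.
rewrite -[i.+1]/(val (Ordinal lt_in)) -[i in leqLHS]/(val (Ordinal (ltnW lt_in))).
rewrite !nth_cols_of.
case/valid_wordP: v => _ h1 _.
have := level_le_step (h1 (Ordinal (ltnW lt_in)) (Ordinal lt_in) erefl).
by rewrite !level_letter /=; lia.
Qed.

Lemma last_cols_of l w D : valid_word l w D -> (last 0%N (cols_of l w) < n)%N.
Proof.
move=> v; have lt_n : (n.-1 < n)%N by rewrite prednK.
rewrite (last_nth 0%N) size_map size_enum_ord -[in nth _ _ n](prednK n_gt0) /=.
rewrite -[n.-1]/(val (Ordinal lt_n)) nth_cols_of.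
case/valid_wordP: v => _ _ h2.
have := level_le_step (h2 (Ordinal lt_n) (prednK n_gt0)).
have := h2 (Ordinal lt_n) (prednK n_gt0).
by rewrite /follows !level_letter /letter /= => /orP[|]; lia.
Qed.

Lemma val_decode l w D : valid_word l w D ->
  val (decode (l, w, D)).1.1 = word_of_cols n 0 (cols_of l w).
Proof.
move=> v; rewrite /= insubdK // -topredE /=.
rewrite size_word_of_cols; first by rewrite size_map size_enum_ord subn0 addnn.
- exact: cols_of_sorted v.
- exact: ltnW (last_cols_of v).
Qed.

Lemma vstep_cols_decode l w D : valid_word l w D ->
  vstep_cols 0 (decode (l, w, D)).1.1 = cols_of l w.
Proof. by move=> v; rewrite val_decode // word_of_colsK ?(cols_of_sorted v). Qed.

Lemma square_decode l w D : valid_word l w D -> square_path (decode (l, w, D)).1.1.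
Proof.
move=> v; rewrite /square_path -(size_vstep_cols 0) vstep_cols_decode //.
by rewrite size_map size_enum_ord eqxx val_decode // last_word_of_cols ?(last_cols_of v).
Qed.

Lemma decodeK l w D : valid_word l w D -> encode (decode (l, w, D)) = (l, w, D).
Proof.
move=> v; have cE := vstep_cols_decode v; rewrite /decode /encode in cE *.
congr (_, _, _); last by apply/setP=> c; rewrite !inE permKV.
apply/ffunP=> c; apply/val_inj; rewrite -(permKV w c); set i := _ c.
rewrite [LHS]levels_ofE /vcol cE nth_cols_of.
by have := valid_level_le i v; rewrite /=; lia.
Qed.

Lemma encodeK p w dv : square_path p -> decode (encode (p, w, dv)) = (p, w, dv).
Proof.
move=> p_sq; rewrite /decode /encode; congr (_, _, _); last first.
  by apply/setP=> i; rewrite !inE permK.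
have -> : cols_of (levels_of p w) w = vstep_cols 0 p.
  apply: (@eq_from_nth _ 0%N); rewrite size_map -cardE card_ord ?size_cols //.
  move=> i lt_in; have := nth_cols_of (levels_of p w) w (Ordinal lt_in).
  rewrite levels_ofE /= => ->.
  by have := vcol_lt p_sq lt_in; rewrite -/(vcol p i); lia.
by rewrite -[n in word_of_cols n](square_path_false p_sq) -[count_mem _ _]add0n vstep_colsK valKd.
Qed.

Lemma area_word_level p w (i : 'I_n) : square_path p ->
  area_word p i = (levels_of p w (w i))%:Z - n%:Z.
Proof.
move=> p_sq; rewrite levels_ofE /area_word.
by have := vcol_lt p_sq (ltn_ord i); lia.
Qed.

(** Columns increase weakly, so the steps in one column are consecutive and comparing neighbours
    suffices. *)
Lemma labelingP p w : square_path p ->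
  reflect (forall i j : 'I_n, i.+1 = j -> vcol p i = vcol p j -> (w i < w j)%N)
    (labeling p w).
Proof.
move=> p_sq; apply: (iffP forallP) => [h i j ij vij|h i].
  by have /forallP/(_ j) := h i; rewrite -{1}ij ltnSn vij eqxx.
apply/forallP=> j; apply/implyP=> /andP[lt_ij /eqP vij].
have {vij} := vij; case: j lt_ij => j /= lt_jn.
elim: j lt_jn => // j IHj lt_jn; rewrite ltnS leq_eqVlt => /orP[/eqP ij|lt_ij] vij.
  by apply: h => //=; rewrite ij.
have m1 : (vcol p i <= vcol p j)%N by apply: vcol_mono => //; lia.
have m2 : (vcol p j <= vcol p j.+1)%N by apply: vcol_mono => //; lia.
apply: (ltn_trans (IHj (ltnW lt_jn) lt_ij _)); first by lia.
by apply: h => //=; lia.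
Qed.

Lemma valid_encode p w dv : square_path p ->
  valid_word (levels_of p w) w [set c | (w^-1)%g c \in dv] =
  labeling p w && [forall i in dv, contractible_valley p w i].
Proof.
move=> p_sq; have lvE i : level_fun (levels_of p w) (letter (w i)) = (n + i - vcol p i)%N.
  by rewrite level_letter levels_ofE.
have decE i : dec_fun [set c | (w^-1)%g c \in dv] (letter (w i)) = (i \in dv).
  by rewrite dec_letter inE permK.
have lt_v (i : 'I_n) := vcol_lt p_sq (ltn_ord i).
have mono (i j : 'I_n) : i.+1 = j -> (vcol p i <= vcol p j)%N.
  by move=> ij; apply: vcol_mono => //; have := ltn_ord j; lia.
apply/valid_wordP/andP=> [[h0 h1 _]|[/labelingP lab /forall_inP val]].
  split; first apply/labelingP=> // i j ij vij.
    have := h1 i j ij; rewrite /follows !lvE decE /letter.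
    have := lt_v i; have := lt_v j; clear -ij vij; case: (j \in dv); lia.
  apply/forall_inP=> i dv_i; rewrite /contractible_valley.
  case: (posnP i) => i0.
    have := h0 i i0; rewrite /follows lvE decE dv_i /= i0 /=.
    rewrite /area_word; have := lt_v i; rewrite i0; clear; lia.
  have lt_i : (i.-1 < n)%N by have := ltn_ord i; lia.
  apply/orP; left; apply/existsP; exists (Ordinal lt_i); rewrite /= prednK // eqxx /=.
  have := h1 (Ordinal lt_i) i; rewrite /= prednK // => /(_ erefl).
  rewrite /follows !lvE decE dv_i /= /area_word /letter.
  have := lt_v i; have := lt_v (Ordinal lt_i); rewrite /=; clear -i0; lia.
split=> [i i0|i j ij|i i_n].
- rewrite /follows lvE decE i0 /letter /=.
  case: (boolP (i \in dv)) => [/val|_]; last by have := lt_v i; rewrite i0; clear -n_gt0; lia.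
  rewrite /contractible_valley i0 => /orP[/existsP[j /andP[/eqP]]//|].
  by rewrite /area_word; have := lt_v i; rewrite i0; clear -n_gt0; lia.
- have mij := mono i j ij; have := lab p_sq i j ij.
  rewrite /follows !lvE decE /letter.
  case: (boolP (j \in dv)) => [/val|_]; last first.
    by have := lt_v i; have := lt_v j; clear -mij ij; lia.
  rewrite /contractible_valley => /orP[/existsP[k /andP[/eqP]]|]; last by rewrite -ij.
  rewrite -ij => -[] /val_inj->; rewrite /area_word.
  by have := lt_v i; have := lt_v j; clear -mij ij; lia.
- by rewrite /follows lvE /=; have := lt_v i; clear -i_n; lia.
Qed.

End Encoding.

Arguments letter {n} c : simpl never.

Lemma attacks_sum (att : rel nat) s : attacks att s =
  (\sum_(0 <= i < size s) \sum_(0 <= j < size s)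
     ((i < j) && att (nth 0 s i) (nth 0 s j)))%N.
Proof.
elim: s => [|d s IHs] /=; first by rewrite big_nil.
rewrite big_nat_recl // big_nat_recl //= add0n; congr addn.
  by rewrite -sum1_count big_mkcond (big_nth 0%N) /=; apply: eq_bigr => i _; case: (att d _).
by rewrite IHs; apply: eq_bigr => i _; rewrite big_nat_recl.
Qed.

(** * The polynomial as a sum over level functions *)

Section LevelSum.

Variable n : nat.
Hypothesis n_gt0 : (0 < n)%N.

Implicit Types (p : (n.*2).-tuple bool) (w : 'S_n) (dv D : {set 'I_n}).
Implicit Types (l : {ffun 'I_n -> 'I_n.*2}).

Definition min_level l : nat := l [arg min_(c < Ordinal n_gt0) l c].

Lemma min_level_le l c : (min_level l <= l c)%N.
Proof. by rewrite /min_level; case: arg_minnP => // d _; apply. Qed.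

Lemma min_levelE l m c : l c = m :> nat -> (forall d, m <= l d)%N -> min_level l = m.
Proof.
move=> lc m_le; apply/eqP; rewrite eqn_leq -{1}lc min_level_le /min_level.
exact: m_le.
Qed.

Lemma attacks_label_word p w dv : square_path p ->
  attacks (attack (level_fun (levels_of p w)) (dec_fun [set c | (w^-1)%g c \in dv]))
    (label_word w)
  = #|[set ij : 'I_n * 'I_n | attack_pair p w dv ij.1 ij.2]|.
Proof.
move=> p_sq; rewrite attacks_sum size_label_word big_mkord.
under eq_bigr => i _ do rewrite big_mkord.
rewrite pair_bigA /= -sum1dep_card [RHS]big_mkcond /=.
apply: eq_bigr => -[i j] _ /=.
rewrite !nth_label_word /attack !level_letter !levels_ofE !dec_letter inE permK.
rewrite /attack_pair /area_word /letter.
have := vcol_lt n_gt0 p_sq (ltn_ord i); have := vcol_lt n_gt0 p_sq (ltn_ord j).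
case: (i \in dv); rewrite /= ?andbF // => lt_j lt_i.
set b := (X in nat_of_bool X); set d := (X in if X then _ else _).
suff -> : b = d by case: d.
by rewrite /b /d; clear -lt_i lt_j; lia.
Qed.

Lemma area_levels p w : square_path p ->
  area p = (\sum_c (levels_of p w c - min_level (levels_of p w)))%N.
Proof.
move=> p_sq; have awE i := area_word_level n_gt0 w i p_sq.
have shiftE : shift p = n%:Z - (min_level (levels_of p w))%:Z.
  have le_m (i : 'I_n) : (min_level (levels_of p w))%:Z - n%:Z <= area_word p i.
    by rewrite awE; have := min_level_le (levels_of p w) (w i); lia.
  rewrite /shift; suff -> : \big[Num.min/area_word p 0]_(i < n) area_word p i
      = (min_level (levels_of p w))%:Z - n%:Z by lia.
  apply/le_anti/andP; split; last first.
    by apply: le_bigmin => [|i _]; [apply: (le_m (Ordinal n_gt0)) | apply: le_m].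
  rewrite /min_level; set c := [arg min_(_ < _) _]%N.
  by apply: (@bigmin_inf _ _ _ _ ((w^-1)%g c)) => //; rewrite awE permKV.
rewrite /area (eq_bigr (fun i : 'I_n =>
  (levels_of p w (w i) - min_level (levels_of p w))%N%:Z)); last first.
  move=> i _; rewrite awE shiftE.
  by have := min_level_le (levels_of p w) (w i); lia.
rewrite -(big_morph Posz PoszD (erefl : Posz 0 = 0)) /=.
by rewrite [RHS](reindex_inj (@perm_inj _ w)).
Qed.

(** Only parity matters, so the number of decorations may be added instead of subtracted, and the
    exponent becomes natural. *)
Lemma sign_dinv p w dv : square_path p ->
  (-1 : int) ^ dinv p w dv =
  (-1) ^+ (#|[set ij : 'I_n * 'I_n | attack_pair p w dv ij.1 ij.2]|
           + #|[set c | (levels_of p w c < n)%N]| + #|dv|).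
Proof.
move=> p_sq; rewrite /dinv.
have -> : #|[set i : 'I_n | area_word p i < 0]| = #|[set c | (levels_of p w c < n)%N]|.
  rewrite -(card_imset _ (@perm_inj _ w)); apply: eq_card => c.
  rewrite !inE -(permKV w c) mem_imset; last exact: perm_inj.
  by rewrite !inE (area_word_level n_gt0 w) //; lia.
set a := #|_|; set b := #|_|; set c := #|_|.
by rewrite -PoszD exprzDr // -exprnN -exprnP !exprD invr_sign.
Qed.

Lemma S_poly_levels k : S_poly n k =
  \sum_(l : {ffun 'I_n -> 'I_n.*2}) \sum_(D : {set 'I_n} | #|D| == k)
    ((-1) ^+ (#|[set c | (l c < n)%N]| + #|D|) *
     \sum_(w : 'S_n) signed_term (attack (level_fun l) (dec_fun D))
        (follows (level_fun l) (dec_fun D)) 0 (label_word w))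
    *: 'X^(\sum_c (l c - min_level l)).
Proof.
pose G (Q : {ffun 'I_n -> 'I_n.*2} * 'S_n * {set 'I_n}) : {poly int} :=
  let: (l, w, D) := Q in
  ((-1) ^+ (#|[set c | (l c < n)%N]| + #|D|) *
   signed_term (attack (level_fun l) (dec_fun D))
     (follows (level_fun l) (dec_fun D)) 0 (label_word w))
  *: 'X^(\sum_c (l c - min_level l)).
pose ok (Q : {ffun 'I_n -> 'I_n.*2} * 'S_n * {set 'I_n}) :=
  let: (l, w, D) := Q in valid_word l w D && (#|D| == k).
transitivity (\sum_(Q | ok Q) G Q); last first.
  transitivity (\sum_(l : {ffun 'I_n -> 'I_n.*2}) \sum_(w : 'S_n)
      \sum_(D : {set 'I_n} | #|D| == k) G (l, w, D)); last first.
    apply: eq_bigr => l _; rewrite exchange_big; apply: eq_bigr => D _.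
    by rewrite mulr_sumr scaler_suml.
  rewrite pair_bigA pair_big_dep /= [RHS]big_mkcond [LHS]big_mkcond /=.
  apply: eq_bigr => -[[l w] D] _ /=; case: (_ == k); rewrite ?andbF // andbT.
  (* Invalid words contribute 0, so the sum extends to all labelings. *)
  by case: ifP => // v; rewrite /signed_term -/(valid_word l w D) v mul0r mulr0 scale0r.
rewrite (reindex_onto (@encode n) (@decode n)); last first.
  by move=> [[l w] D] /andP[v _]; apply: decodeK.
have cardE w dv : #|[set c | (w^-1)%g c \in dv]| = #|dv|.
  rewrite -(card_imset dv (@perm_inj _ w)); apply: eq_card => c.
  by rewrite inE -{2}(permKV w c) mem_imset //; apply: perm_inj.
rewrite /S_poly; apply: eq_big => [[[p w] dv]|[[p w] dv]].
  rewrite inE; apply/idP/andP => [/and4P[p_sq lab val /eqP cdv]|].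
    by rewrite encodeK // /= valid_encode // lab val cardE cdv !eqxx.
  case=> /andP[v cdv] /eqP dK; have := square_decode n_gt0 v.
  rewrite -[(_, _, _)]/(encode (p, w, dv)) dK /= => p_sq; rewrite p_sq /= andbA -valid_encode //.
  by move: v; rewrite /= => ->; rewrite -(cardE w).
rewrite inE => /and4P[p_sq lab val /eqP cdv].
rewrite (sign_dinv w dv p_sq) (area_levels w p_sq) /= /signed_term.
rewrite -/(valid_word _ _ _) valid_encode // lab val mul1r cardE.
rewrite attacks_label_word //; congr (_ *: _).
by rewrite -addnA exprD mulrC.
Qed.

Definition level_schedule l D (c : 'I_n) : nat :=
  schedule_number n (level_fun l) (dec_fun D) (letters n) (letter c).

Lemma signed_sum_levels l D :
  (-1) ^+ (#|[set c | (l c < n)%N]| + #|D|) *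
     (\sum_(w : 'S_n) signed_term (attack (level_fun l) (dec_fun D))
        (follows (level_fun l) (dec_fun D)) 0 (label_word w)) =
  (-1) ^+ #|[set c | (l c < n)%N && (c \notin D)]|
    * [forall c, odd (level_schedule l D c)]%:R.
Proof.
rewrite -sum_arrangements_letters mulr_sumr.
have eq1 : (\sum_(c <- letters n) ((level_fun l c < n) + dec_fun D c) =
    #|[set c | (l c < n)%N]| + #|D|)%N.
  rewrite big_map big_enum (eq_bigr (fun c => (l c < n) + (c \in D))%N) => [|c _].
    rewrite big_split /= -sum1dep_card -sum1_card [in RHS]big_mkcond; congr addn.
    by rewrite [RHS]big_mkcond.
  by rewrite level_letter dec_letter.
have eq2 : count (fun c => (level_fun l c < n)%N && ~~ dec_fun D c) (letters n)
    = #|[set c | (l c < n)%N && (c \notin D)]|.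
  rewrite count_map -size_filter cardE; congr size.
  rewrite /enum_mem -filter_predI; apply: eq_in_filter => c _ /=.
  by rewrite valK !inE andbT.
have eq3 : all (fun c => odd (schedule_number n (level_fun l) (dec_fun D) (letters n) c))
    (letters n) = [forall c, odd (level_schedule l D c)].
  rewrite all_map; apply/allP/forallP => h c; first by apply: h; rewrite mem_enum.
  by move=> _; apply: h.
by rewrite -eq1 -eq2 -eq3; apply: signed_count (uniq_letters n) (@letters_gt1 n).
Qed.

Lemma S_poly_product k : S_poly n k =
  \sum_(l : {ffun 'I_n -> 'I_n.*2}) \sum_(D : {set 'I_n} | #|D| == k)
    ((-1) ^+ #|[set c | (l c < n)%N && (c \notin D)]|
      * [forall c, odd (level_schedule l D c)]%:R)
    *: 'X^(\sum_c (l c - min_level l)).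
Proof.
rewrite S_poly_levels; apply: eq_bigr => l _; apply: eq_bigr => D _.
by rewrite signed_sum_levels.
Qed.

(** The signed sum over label words is then 1 or -1, so not all its terms vanish. *)
Lemma odd_schedule_valid l D :
  [forall c, odd (level_schedule l D c)] -> exists w, valid_word l w D.
Proof.
move=> odd_all; apply/existsP; apply/contraT; rewrite negb_exists => /forallP h.
have := signed_sum_levels l D; rewrite odd_all mulr1 big1 => [|w _].
  by rewrite mulr0 => /esym/eqP; rewrite signr_eq0.
by rewrite /signed_term -/(valid_word l w D) (negPf (h w)) mul0r.
Qed.

Lemma mem_label_word w m : m \in label_word w -> exists c : 'I_n, m = letter c.
Proof. by case/mapP=> i _ ->; exists (w i). Qed.

Lemma letter_label_word w (c : 'I_n) : letter c \in label_word w.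
Proof. by apply/mapP; exists ((w^-1)%g c); rewrite ?mem_enum // permKV. Qed.

(** Follow the word from the virtual letter 0 to [c]; that virtual letter has level n - 1 < j, so
    both letters of the crossing pair are real. *)
Lemma crossing_above l w D c j : valid_word l w D -> (n <= j < l c)%N ->
  exists d e : 'I_n, [/\ (d < e)%N, l d = j :> nat & l e = j.+1 :> nat].
Proof.
rewrite /valid_word rcons_path => /andP[w_path _] /andP[le_nj lt_jc].
have lt_d: (level_fun l 0 <= j)%N by rewrite /=; lia.
have [|d [e [w_d w_e lt_de ld le]]] := crossing w_path lt_d.
  apply/hasP; exists (letter c); first exact: letter_label_word.
  by rewrite level_letter.
have [e' e_e'] := mem_label_word w_e.
move: w_d; rewrite inE => /orP[/eqP d0|/mem_label_word[d' d_d']].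
  by move: ld; rewrite d0 /=; lia.
exists d', e'; rewrite e_e' d_d' !level_letter in ld le lt_de *.
by split; move: lt_de; rewrite /letter; lia.
Qed.

(** Follow the word from [c] to the virtual letter 1; it is not the lower member of the pair since
    its level n exceeds [j], nor the upper one since it is smaller than every real letter. *)
Lemma crossing_below l w D c j : valid_word l w D -> (l c <= j < n)%N ->
  exists d e : 'I_n, [/\ (d < e)%N, l d = j :> nat & l e = j.+1 :> nat].
Proof.
have [x1 [x2 xE]] : exists x1 x2, label_word w = x1 ++ letter c :: x2.
  by case/splitPr: (letter_label_word w c) => x1 x2; exists x1, x2.
have sub m : m \in x2 -> m \in label_word w.
  by move=> x_m; rewrite xE mem_cat inE x_m !orbT.
rewrite /valid_word xE -cats1 -catA cat_path /= => /and3P[_ _ c_path] /andP[le_cj lt_jn].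
have lt_d: (level_fun l (letter c) <= j)%N by rewrite level_letter.
have [|d [e [w_d w_e lt_de ld le]]] := crossing c_path lt_d.
  by apply/hasP; exists 1%N; rewrite ?mem_cat ?inE ?eqxx ?orbT.
have {w_d} : d = 1%N \/ exists d' : 'I_n, d = letter d'.
  move: w_d; rewrite inE mem_cat inE => /or3P[/eqP->|x_d|/eqP->]; [right|right|left] => //.
    by exists c.
  by apply: (@mem_label_word w); apply: sub.
have {w_e} : e = 1%N \/ exists e' : 'I_n, e = letter e'.
  move: w_e; rewrite mem_cat inE => /orP[x_e|/eqP->]; [right|left] => //.
  by apply: (@mem_label_word w); apply: sub.
case=> [e1|[e' e_e']] [d1|[d' d_d']].
- by move: lt_de; rewrite e1 d1.
- by move: lt_de; rewrite e1 d_d'.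
- by move: ld; rewrite d1 /=; lia.
exists d', e'; rewrite e_e' d_d' !level_letter in ld le lt_de *.
by split; move: lt_de; rewrite /letter; lia.
Qed.

Lemma level_crossing l w D c c' j : valid_word l w D -> (l c <= j < l c')%N ->
  exists d e : 'I_n, [/\ (d < e)%N, l d = j :> nat & l e = j.+1 :> nat].
Proof.
move=> v /andP[cj jc']; case: (ltnP j n) => jn.
  by apply: (crossing_below (c := c) v); rewrite cj.
by apply: (crossing_above (c := c') v); rewrite jn.
Qed.

(** The first letter has level at most n and the last at least n, so level n is met or crossed. This
    makes the zero run exist. *)
Lemma valid_level_zero l w D : valid_word l w D -> exists c, l c = n :> nat.
Proof.
move=> v; have lt_n : (n.-1 < n)%N by rewrite prednK.
have := valid_wordP n_gt0 l w D; rewrite v => /elimT/(_ isT)[h0 _ h2].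
have := h0 (Ordinal n_gt0) erefl; have := h2 (Ordinal lt_n) (prednK n_gt0).
set c := w _; set c' := w _; rewrite /follows !level_letter /=.
move=> le_c le_c'; have {}le_c : (n <= l c)%N by move: le_c; rewrite /letter; lia.
have {}le_c' : (l c' <= n)%N by move: le_c'; rewrite /letter; lia.
case: (ltngtP (l c) n) => [|lt_c|]; [lia| |by exists c].
have [|d [e [_ ld _]]] := @level_crossing l w D c' c n v; first by rewrite le_c'.
by exists d.
Qed.

End LevelSum.

(** * Decreasing runs *)

Section Runs.

Variable n : nat.
Implicit Types (s : seq 'I_n) (c x y : 'I_n) (sigma : 'S_n) (D : {set 'I_n}).

Definition run_rank s c : nat :=
  find (fun r : seq 'I_n => c \in r) (decreasing_runs s).

Lemma decreasing_runs_cons x s :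
  exists r rs, decreasing_runs (x :: s) = (x :: r) :: rs.
Proof.
elim: s x => [|y s IHs] x; first by exists [::], [::].
have [r [rs eq_y]] := IHs y.
rewrite [decreasing_runs _]/= -/(decreasing_runs (y :: s)) eq_y.
by case: ifP => _; [exists (y :: r), rs | exists [::], ((y :: r) :: rs)].
Qed.

Lemma decreasing_runs_cons2 x y s r rs :
  decreasing_runs (y :: s) = (y :: r) :: rs ->
  decreasing_runs (x :: y :: s) =
    if (y < x)%N then (x :: y :: r) :: rs else [:: x] :: (y :: r) :: rs.
Proof. by move=> eq_y; rewrite [LHS]/= -/(decreasing_runs (y :: s)) eq_y. Qed.

Lemma flatten_decreasing_runs s : flatten (decreasing_runs s) = s.
Proof.
elim: s => [|x [|y s] IHs] //.
have [r [rs eq_y]] := decreasing_runs_cons y s.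
rewrite (decreasing_runs_cons2 _ eq_y); rewrite eq_y /= in IHs.
by case: ifP => _ /=; rewrite IHs.
Qed.

Lemma decreasing_runs_sorted s :
  all (sorted (fun x y => y < x)%N) (decreasing_runs s).
Proof.
elim: s => [|x [|y s] IHs] //.
have [r [rs eq_y]] := decreasing_runs_cons y s.
rewrite (decreasing_runs_cons2 _ eq_y); rewrite eq_y /= in IHs.
by case: ifP => /= yx; rewrite ?yx IHs.
Qed.

Lemma decreasing_runs_neq0 s : all (fun r => 0 < size r)%N (decreasing_runs s).
Proof.
elim: s => [|x [|y s] IHs] //.
have [r [rs eq_y]] := decreasing_runs_cons y s.
rewrite (decreasing_runs_cons2 _ eq_y); rewrite eq_y /= in IHs.
by case: ifP => /= yx; rewrite IHs.
Qed.

Lemma size_decreasing_runs s : (size (decreasing_runs s) <= size s)%N.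
Proof.
rewrite -{2}(flatten_decreasing_runs s); have := decreasing_runs_neq0 s.
elim: decreasing_runs => //= r rs IHr /andP[r0 /IHr]; rewrite size_cat; lia.
Qed.

Lemma run_rank_lt s c : c \in s -> (run_rank s c < size (decreasing_runs s))%N.
Proof.
rewrite -{1}(flatten_decreasing_runs s) -has_find => /flattenP[r s_r c_r].
by apply/hasP; exists r.
Qed.

Lemma run_rank_head x s : run_rank (x :: s) x = 0%N.
Proof.
have [r [rs eq_x]] := decreasing_runs_cons x s.
by rewrite /run_rank eq_x /= mem_head.
Qed.

Lemma run_rank_cons2 x y s c : c != x -> run_rank (x :: y :: s) c =
  if (y < x)%N then run_rank (y :: s) c else (run_rank (y :: s) c).+1.
Proof.
move=> /negPf c_x; have [r [rs eq_y]] := decreasing_runs_cons y s.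
rewrite /run_rank (decreasing_runs_cons2 _ eq_y) eq_y.
by case: ifP => _; rewrite /= !inE c_x.
Qed.

Definition run_step (r : 'I_n -> nat) x y : bool :=
  if (y < x)%N then r y == r x else r y == (r x).+1.

Lemma run_rank_path x s :
  uniq (x :: s) -> path (run_step (run_rank (x :: s))) x s.
Proof.
elim: s x => // y s IHs x /= /andP[x_ys u_ys].
have neq_x c : c \in y :: s -> c != x by move=> c_ys; apply: contraNneq x_ys => <-.
have := IHs y u_ys; rewrite {2}/run_step run_rank_cons2 ?neq_x ?mem_head //.
rewrite !run_rank_head => y_path; rewrite (_ : (if _ then _ else _) = true); last first.
  by case: (y < x)%N.
apply: (sub_in_path (P := mem (y :: s)) _ _ y_path); last by apply/allP.
move=> a b a_ys b_ys.
rewrite /run_step !run_rank_cons2 ?neq_x //.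
by case: (y < x)%N => //; rewrite !eqSS.
Qed.

(** Serves to identify levels with run indices: growing by one exactly at the ascents determines a
    function up to a constant. *)
Lemma run_rank_unique r x s c : uniq (x :: s) -> path (run_step r) x s ->
  c \in x :: s -> r c = (r x + run_rank (x :: s) c)%N.
Proof.
elim: s x => [|y s IHs] x.
  by move=> _ _; rewrite inE => /eqP->; rewrite run_rank_head addn0.
move=> /= /andP[x_ys u_ys] /andP[xy_step y_path].
rewrite in_cons; case: (eqVneq c x) => [-> _|c_x /= c_ys].
  by rewrite run_rank_head addn0.
rewrite run_rank_cons2 // (IHs y u_ys y_path c_ys); move: xy_step; rewrite /run_step.
by case: ifP => _ /eqP->; rewrite ?addnS.
Qed.

Lemma nth_flatten_find (ss : seq (seq 'I_n)) i : uniq (flatten ss) ->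
  nth [::] ss i = [seq d <- flatten ss | find (fun r : seq 'I_n => d \in r) ss == i].
Proof.
elim: ss i => [|r ss IHs] i; first by rewrite nth_nil.
rewrite /= cat_uniq filter_cat => /and3P[u_r r_ss u_ss].
pose idx d :=
  if d \in r then 0%N else (find (fun r0 : seq 'I_n => d \in r0) ss).+1.
have r_in d : d \in r -> idx d = 0%N by rewrite /idx => ->.
have ss_in d : d \in flatten ss ->
    idx d = (find (fun r0 : seq 'I_n => d \in r0) ss).+1.
  by move=> d_ss; rewrite /idx ifN //; apply: (hasPn r_ss).
rewrite -[filter _ r]/[seq d <- r | idx d == i].
rewrite -[filter _ (flatten ss)]/[seq d <- flatten ss | idx d == i].
case: i => [|i] /=.
  rewrite (eq_in_filter (a2 := xpredT)) => [|d /r_in-> //].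
  rewrite [X in _ ++ X](eq_in_filter (a2 := xpred0)) => [|d /ss_in-> //].
  by rewrite filter_predT filter_pred0 cats0.
rewrite (eq_in_filter (a2 := xpred0)) => [|d /r_in-> //]; rewrite filter_pred0.
by rewrite IHs //; apply: eq_in_filter => d /ss_in->; rewrite eqSS.
Qed.

End Runs.

Lemma maj_rcons t x : maj (rcons t x) = (maj t + (x < last 0 t) * size t)%N.
Proof.
case: (lastP t) => [|t' y]; first by rewrite /maj /= !big_ord0.
rewrite /maj !size_rcons /= last_rcons big_mkcond big_ord_recr /= [in RHS]big_mkcond /=.
rewrite !nth_rcons !size_rcons ltnn eqxx ltnSn ltnn eqxx.
by congr addn; [apply: eq_bigr => i _; rewrite !nth_rcons !size_rcons !ltnS
  (ltnW (ltn_ord i)) ltn_ord | case: (x < y)%N; rewrite ?mul1n].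
Qed.

(** * Permutations as words, [revmaj], and schedule numbers from levels *)

Section Words.

Variable n : nat.
Implicit Types (s : seq 'I_n) (c d : 'I_n) (sigma : 'S_n) (D : {set 'I_n}).

(** Prepending x to a word beginning with y changes something only if x < y: the reversed word gains
    a descent at the length of the old word, and each old letter moves up by one run. *)
Lemma maj_rev_run_rank s : uniq s ->
  maj (rev [seq val c | c <- s]) = (\sum_(c <- s) run_rank s c)%N.
Proof.
elim: s => [_|x [|y s] IHs]; first by rewrite big_nil /maj /= big_ord0.
  by rewrite big_seq1 run_rank_head /maj /= big_ord0.
rewrite cons_uniq => /andP[x_ys u_ys].
rewrite map_cons rev_cons maj_rcons IHs // size_rev size_map map_cons rev_cons last_rcons.
rewrite [RHS]big_cons run_rank_head add0n.
have neq_x c : c \in y :: s -> c != x by move=> c_ys; apply: contraNneq x_ys => <-.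
have := neq_x y (mem_head _ _); rewrite -val_eqE /= => y_x.
under [RHS]eq_big_seq => c c_ys do rewrite run_rank_cons2 ?neq_x //.
case: (ltngtP y x) y_x => // _ _; first by rewrite mul0n addn0.
rewrite [RHS](eq_bigr (fun c => 1 + run_rank (y :: s) c)%N) // big_split /=.
by rewrite sum1_size mul1n addnC.
Qed.

Lemma uniq_word sigma : uniq (word sigma).
Proof. by rewrite map_inj_uniq ?enum_uniq //; apply: perm_inj. Qed.

Lemma mem_word sigma c : c \in word sigma.
Proof. by apply/mapP; exists ((sigma^-1)%g c); rewrite ?mem_enum // permKV. Qed.

Lemma perm_word sigma : perm_eq (word sigma) (enum 'I_n).
Proof. by apply: uniq_perm; rewrite ?uniq_word ?enum_uniq // => c; rewrite mem_word mem_enum. Qed.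

Lemma word_inj : injective (@word n).
Proof.
have nthE sigma (i : 'I_n) : nth i (word sigma) i = sigma i.
  by rewrite (nth_map i) ?size_enum_ord // nth_ord_enum.
by move=> s1 s2 e12; apply/permP=> i; rewrite -!nthE e12.
Qed.

Lemma word_surj s : perm_eq s (enum 'I_n) -> exists sigma, word sigma = s.
Proof.
move=> p_s; have : perm_eq s (tval [tuple i | i < n]) by rewrite /= map_id.
case/tuple_permP=> sigma ->; exists sigma.
by apply: eq_map => i /=; rewrite tnth_mktuple.
Qed.

Lemma revmajE sigma : revmaj sigma = (\sum_c run_index sigma c)%N.
Proof.
by rewrite /revmaj maj_rev_run_rank ?uniq_word // (perm_big _ (perm_word sigma)) big_enum.
Qed.

Lemma run_index_lt sigma c : (run_index sigma c < size (runs sigma))%N.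
Proof. exact: run_rank_lt (mem_word sigma c). Qed.

Lemma size_runs sigma : (size (runs sigma) <= n)%N.
Proof.
by apply: leq_trans (size_decreasing_runs _) _; rewrite size_map size_enum_ord.
Qed.

Lemma count_undecorated_run sigma D (P : pred 'I_n) i :
  count P (undecorated_run sigma D i) =
  (\sum_d [&& P d, run_index sigma d == i & d \notin D])%N.
Proof.
rewrite /undecorated_run /runs nth_flatten_find flatten_decreasing_runs ?uniq_word //.
rewrite !count_filter (seq.permP (perm_word sigma)) -sum1_count big_mkcond big_enum /=.
by apply: eq_bigr => d _; case: (P d); case: (d \in D); rewrite //= ?andbF ?andbT;
  case: (_ == i).
Qed.

Lemma shifted_level_lt sigma (s : 'I_n) c : (n + run_index sigma c - s < n.*2)%N.
Proof. by have := run_index_lt sigma c; have := size_runs sigma; lia. Qed.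

Definition shifted_levels (x : 'S_n * 'I_n) : {ffun 'I_n -> 'I_n.*2} :=
  [ffun c => Ordinal (shifted_level_lt x.1 x.2 c)].

Lemma level_scheduleE (l : {ffun 'I_n -> 'I_n.*2}) D c : level_schedule l D c =
  (\sum_d ((d \notin D) &&
     if (l c < n)%N || (c \in D)
     then (l d == l c :> nat) && (d < c)%N || (l d == (l c).+1 :> nat) && (c < d)%N
     else (l d == l c :> nat) && (c < d)%N
          || [&& l c == (l d).+1 :> nat, (n <= l d)%N & (d < c)%N])
   + [&& l c == n :> nat & c \notin D])%N.
Proof.
rewrite /level_schedule /schedule_number level_letter dec_letter; congr addn.
rewrite count_map -sum1_count big_mkcond big_enum; apply: eq_bigr => d _.
rewrite /preim /scheduled inE !level_letter !dec_letter /letter !ltnS.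
by case: (_ && _).
Qed.

Lemma level_schedule_shifted sigma (s : 'I_n) D c : (s < size (runs sigma))%N ->
  level_schedule (shifted_levels (sigma, s)) D c = schedule sigma D s c.
Proof.
move=> s_lt; rewrite level_scheduleE /schedule (leqNgt (size _)) s_lt !count_undecorated_run /=.
have le_sn := ltn_ord s; rewrite !ffunE /=.
have -> : (n + run_index sigma c - s < n)%N = (run_index sigma c < s)%N.
  by clear -le_sn; lia.
have -> : (n + run_index sigma c - s == n)%N = (run_index sigma c == s :> nat).
  by clear -le_sn; lia.
case: ifP => [neg|/negbT].
  rewrite -big_split /= (_ : (_ && _ : nat) = 0%N) ?addn0; last first.
    by case: (c \in D) neg => /=; rewrite ?andbF ?orbF //; clear; lia.
  apply: eq_bigr => d _; rewrite ffunE /=.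
  by case: (d \in D); rewrite /= ?andbF // !andbT; clear -le_sn; lia.
rewrite negb_or -leqNgt => /andP[le_s ->]; rewrite andbT.
case: ifP => [/eqP eq_s|/negbT neq_s].
  congr addn; apply: eq_bigr => d _; rewrite ffunE /=.
  by case: (d \in D); rewrite /= ?andbF // !andbT; clear -le_sn eq_s; lia.
rewrite addn0 -big_split /=; apply: eq_bigr => d _; rewrite ffunE /=.
case: (d \in D); rewrite /= ?andbF // !andbT; clear -le_sn le_s neq_s; lia.
Qed.

End Words.

(** * Valid level functions are shifted run indices *)

Section Shifts.

Variable n : nat.
Hypothesis n_gt0 : (0 < n)%N.
Implicit Types (c d : 'I_n) (sigma : 'S_n) (D : {set 'I_n}).
Implicit Types (l : {ffun 'I_n -> 'I_n.*2}).

Definition level_lex l c d : bool :=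
  (l c < l d)%N || (l c == l d :> nat) && (d < c)%N.

Lemma level_lex_trans l : transitive (level_lex l).
Proof. by move=> b a c; rewrite /level_lex; lia. Qed.

Lemma level_lex_irr l : irreflexive (level_lex l).
Proof. by move=> c; rewrite /level_lex; lia. Qed.

Lemma word_cons sigma : exists c t, word sigma = c :: t.
Proof.
have: (0 < size (word sigma))%N by rewrite size_map size_enum_ord.
by case: (word sigma) => // c t _; exists c, t.
Qed.

Lemma run_index_head sigma c t : word sigma = c :: t -> run_index sigma c = 0%N.
Proof. by rewrite /run_index /runs => ->; apply: run_rank_head. Qed.

Lemma shifted_levelE sigma (s : 'I_n) c :
  shifted_levels (sigma, s) c = (n + run_index sigma c - s)%N :> nat.
Proof. by rewrite ffunE. Qed.

Lemma word_level_sorted sigma (s : 'I_n) :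
  sorted (level_lex (shifted_levels (sigma, s))) (word sigma).
Proof.
have [c [t eq_w]] := word_cons sigma.
have := run_rank_path (s := t) (x := c); rewrite -eq_w uniq_word => /(_ isT).
rewrite {2}eq_w /=; apply: sub_path => x y.
rewrite /run_step /level_lex !shifted_levelE.
rewrite -[run_rank _ x]/(run_index sigma x) -[run_rank _ y]/(run_index sigma y).
by have := ltn_ord s; case: ifP => yx lt_s /eqP->; lia.
Qed.

(** The word is the list of letters sorted by [level_lex], so the levels determine the permutation;
    the level n - s of its first letter determines the shift. *)
Lemma shifted_levels_inj : injective (@shifted_levels n).
Proof.
move=> [s1 i1] [s2 i2] eq_l; have eq_s : s1 = s2.
  apply: word_inj; apply: (irr_sorted_eq (@level_lex_trans _) (@level_lex_irr _)).
  - exact: word_level_sorted s1 i1.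
  - rewrite eq_l; exact: word_level_sorted.
  - by move=> c; rewrite !mem_word.
rewrite -eq_s in eq_l *; congr (_, _); apply: val_inj => /=.
have [c [t eq_w]] := word_cons s1.
have := congr1 (fun l : {ffun 'I_n -> 'I_n.*2} => l c : nat) eq_l.
rewrite !shifted_levelE (run_index_head eq_w).
by have := ltn_ord i1; have := ltn_ord i2; lia.
Qed.

Lemma area_shifted sigma (s : 'I_n) :
  (\sum_c (shifted_levels (sigma, s) c - min_level n_gt0 (shifted_levels (sigma, s))))%N
  = revmaj sigma.
Proof.
have [c [t eq_w]] := word_cons sigma.
rewrite (min_levelE n_gt0 (m := (n - s)%N) (c := c)).
- rewrite revmajE; apply: eq_bigr => d _; rewrite shifted_levelE.
  by have := ltn_ord s; lia.
- by rewrite shifted_levelE (run_index_head eq_w) addn0.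
- by move=> d; rewrite shifted_levelE; lia.
Qed.

Lemma valid_levels_shifted l w D : valid_word l w D ->
  exists x : 'S_n * 'I_n, (x.2 < size (runs x.1))%N /\ shifted_levels x = l.
Proof.
move=> v; pose le c d := (l c < l d)%N || (l c == l d :> nat) && (d <= c)%N.
have le_trans : transitive le by move=> b a c; rewrite /le; lia.
have le_total : total le by move=> c d; rewrite /le; lia.
have [sigma eq_w] := word_surj (s := sort le (enum 'I_n)) (permEl (perm_sort _ _)).
have [c0 [t eq_wt]] := word_cons sigma.
have w_sorted : sorted le (word sigma) by rewrite eq_w sort_sorted.
have le_refl : reflexive le by move=> c; rewrite /le; lia.
have le_nth := sorted_leq_nth le_trans le_refl c0 w_sorted.
have mem_size c : (index c (word sigma) < size (word sigma))%N.
  by rewrite index_mem mem_word.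
have c0_min c : (l c0 <= l c)%N.
  have := le_nth 0%N (index c (word sigma)); rewrite !inE mem_size nth_index ?mem_word //.
  by rewrite eq_wt /= /le => /(_ isT isT isT); lia.
have step : path (run_step (fun c => l c - l c0)%N) c0 t.
  apply/(pathP c0) => i lt_i; rewrite -eq_wt.
  have lt_i1 : (i.+1 < size (word sigma))%N by rewrite eq_wt.
  have -> : nth c0 t i = nth c0 (word sigma) i.+1 by rewrite eq_wt.
  set e := nth c0 _ i; set f := nth c0 _ i.+1.
  have near c : le c e \/ le f c.
    have := le_nth (index c (word sigma)) i; have := le_nth i.+1 (index c (word sigma)).
    rewrite !inE mem_size lt_i1 (ltnW lt_i1) nth_index ?mem_word // => h1 h2.
    by case: (leqP (index c (word sigma)) i) => h; [left; apply: h2 | right; apply: h1].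
  have neq_ef : e != f :> nat.
    by rewrite val_eqE /e /f nth_uniq ?uniq_word // ?neq_ltn ?ltnSn // ltnW.
  have : le e f by apply: le_nth; rewrite ?inE // ltnW.
  rewrite /le /run_step => /orP[lt_l|/andP[/eqP-> le_fe]]; last first.
    by rewrite ifT //; lia.
  (* No letter lies strictly between [e] and [f] in the order [le]: [e] is the smallest letter of
     its level and [f] the largest of the next occupied one. The crossing pair thus gives e <= d <
     e' <= f and l f = l e + 1, an ascent between runs. *)
  have [|d [e' [lt_de ld le']]] := @level_crossing _ n_gt0 l w D e f (l e) v.
    by rewrite leqnn.
  have le_ed : (e <= d)%N.
    by case: (near d); rewrite /le; lia.
  have [lf le_f] : l f = (l e).+1 :> nat /\ (e' <= f)%N.
    by case: (near e'); rewrite /le; lia.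
  have := c0_min e; rewrite lf; case: ifP; lia.
have riE c : run_index sigma c = (l c - l c0)%N.
  have := run_rank_unique _ step; rewrite -eq_wt => /(_ _ (uniq_word _) (mem_word _ c)).
  by rewrite subnn.
have [cz lcz] := valid_level_zero n_gt0 v.
have le_c0n : (l c0 <= n)%N by have := c0_min cz; rewrite lcz.
have lt_r : (n - l c0 < size (runs sigma))%N by have := run_index_lt sigma cz; rewrite riE lcz.
have lt_s : (n - l c0 < n)%N := leq_trans lt_r (size_runs sigma).
exists (sigma, Ordinal lt_s); split=> //.
apply/ffunP=> c; apply/val_inj; rewrite [LHS]shifted_levelE /= riE.
by have := c0_min c; lia.
Qed.

End Shifts.

(** * Interlacing of consecutive runs *)

Section Interlacing.

Implicit Types (u v : seq nat) (c : nat).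

(** The order is a parameter because the condition on negative runs is that on positive runs for the
    reversed order, with the two runs exchanged. *)
Definition forward_ok (lt : rel nat) u v : bool :=
  all (fun c => odd (count (lt c) v + count (lt^~ c) u)) v.

(** Let b1 >= b2 >= b3 count the letters of [u] below the three top letters of [v]. Oddness of b1, 1
    + b2, 2 + b3 with b1 <= 2 forces b1 = 1 and b2 = b3 = 0, so a third letter would have the even
    number 2. *)
Lemma forward_step (lt : rel nat) u v : transitive lt -> irreflexive lt ->
  sorted (fun a b => lt b a) v -> (size u <= 2)%N -> forward_ok lt u v ->
  [/\ (size v <= 2)%N,
      all (fun c => count (lt c) v + count (lt^~ c) u == 1)%N v
    & u = [::] -> v = [::]].
Proof.
move=> lt_trans lt_irr v_sorted size_u.
have below_le a b : lt a b -> (count (lt^~ a) u <= count (lt^~ b) u)%N.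
  by move=> ab; apply: sub_count => d /= da; apply: lt_trans ab.
have below2 a : (count (lt^~ a) u <= 2)%N.
  by apply: leq_trans (count_size _ _) size_u.
have nabove a b r : path (fun a b => lt b a) b r -> a = b \/ lt b a -> count (lt a) r = 0%N.
  move=> b_path ab; apply/eqP; rewrite -leqn0 leqNgt -has_count; apply/hasPn => d r_d.
  have gt_trans : transitive (fun a b => lt b a) by move=> x y z xy yz; apply: lt_trans yz xy.
  have := allP (order_path_min gt_trans b_path) _ r_d => db.
  apply/negP=> ad; have: lt d d; last by rewrite lt_irr.
  case: ab => [ab|ba]; first by apply: (lt_trans b); rewrite // -ab.
  by apply: (lt_trans b) => //; apply: (lt_trans a).
have nlt a b : lt a b -> lt b a = false.
  by move=> ab; apply/negP=> ba; have := lt_trans _ _ _ ab ba; rewrite lt_irr.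
case: v v_sorted => [|c1 [|c2 [|c3 r]]] //=.
- rewrite /forward_ok /= lt_irr !andbT => _ odd1; have le2 := below2 c1.
  by split=> //; [lia | move=> u0; move: odd1; rewrite u0].
- rewrite /forward_ok /= !lt_irr !andbT => c21; rewrite c21 (nlt _ _ c21) => odd1.
  have le2 := below2 c1; have le12 := below_le _ _ c21.
  by split=> //; [lia | move=> u0; move: odd1; rewrite u0].
rewrite /forward_ok /= => /and3P[c21 c32 r_path].
have c31 := lt_trans _ _ _ c32 c21.
rewrite !lt_irr c21 c32 c31 (nlt _ _ c21) (nlt _ _ c32) (nlt _ _ c31).
rewrite (nabove c3 c3 r) //; last by left.
rewrite (nabove c2 c3 r) //; last by right.
rewrite (nabove c1 c3 r) //; last by right.
by have := below2 c1; have := below_le _ _ c21; have := below_le _ _ c32; lia.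
Qed.

(** Both conditions say that the two runs interlace, so the side of the zero run on which they lie
    is irrelevant. *)
Lemma forward_backward u v :
  sorted (fun a b => b < a)%N u -> sorted (fun a b => b < a)%N v ->
  (0 < size u <= 2)%N -> (0 < size v <= 2)%N ->
  forward_ok ltn u v = forward_ok gtn v u.
Proof.
case: u => [|d1 [|d2 [|]]] //; case: v => [|c1 [|c2 [|]]] //=;
rewrite /forward_ok /= !ltnn /=; lia.
Qed.

(** With at most four letters only the value 3 has to be excluded; interlacing excludes it, and if
    one run is empty the count is at most 2. *)
Lemma interlaced_parity u v c :
  sorted (fun a b => b < a)%N u -> sorted (fun a b => b < a)%N v ->
  (size u <= 2)%N -> (size v <= 2)%N ->
  (u != [::] -> v != [::] -> forward_ok ltn u v) ->
  odd (count (ltn^~ c) u + count (ltn c) v) ->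
  (count (ltn^~ c) u + count (ltn c) v = 1)%N.
Proof.
case: u => [|d1 [|d2 [|]]] //; case: v => [|c1 [|c2 [|]]] //=;
rewrite /forward_ok /= ?ltnn /= => u_sorted v_sorted _ _ h;
  try (have {h} := h isT isT); lia.
Qed.

Lemma backward_step u v : sorted (fun a b => b < a)%N u -> (size v <= 2)%N ->
  forward_ok gtn v u ->
  [/\ (size u <= 2)%N,
      all (fun c => count (gtn c) u + count (gtn^~ c) v == 1)%N u
    & v = [::] -> u = [::]].
Proof.
move=> u_sorted size_v ok_u.
have gt_trans : transitive gtn by move=> a b c /= ab bc; apply: ltn_trans bc ab.
have gt_irr : irreflexive gtn by move=> a /=; rewrite ltnn.
have rev_sorted : sorted (fun a b => gtn b a) (rev u) by rewrite rev_sorted.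
have rev_ok : forward_ok gtn v (rev u).
  by rewrite /forward_ok all_rev; under eq_all => c do rewrite count_rev.
have [h1 h2 h3] := forward_step gt_trans gt_irr rev_sorted size_v rev_ok.
split; first by rewrite size_rev in h1.
  by move: h2; rewrite all_rev; under eq_all => c do rewrite count_rev.
by move/h3/(congr1 size); rewrite size_rev => /size0nil.
Qed.

Definition zero_ok v : bool := all (fun c => odd (count (ltn c) v).+1) v.

Lemma zero_ok_size v : sorted (fun a b => b < a)%N v -> zero_ok v -> (size v <= 1)%N.
Proof.
case: v => [|c1 [|c2 r]] //= /andP[c21 r_path]; rewrite /zero_ok /= !ltnn c21.
have gt_trans : transitive (fun a b => b < a)%N.
  by move=> a b c ab bc; apply: ltn_trans bc ab.
have r_lt := allP (order_path_min gt_trans r_path).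
have -> : count (ltn c2) r = 0%N.
  apply/eqP; rewrite -leqn0 leqNgt -has_count; apply/hasPn => d r_d /=.
  by rewrite -leqNgt ltnW // r_lt.
by rewrite /= andbF.
Qed.

End Interlacing.

(** * Shifts for which all schedule numbers are odd *)

Section Alternation.

(* [u i] lists the undecorated letters of the i-th of [L] runs; [dl i c] says
   that [c] is a decorated letter of that run. *)
Variables (L : nat) (u : nat -> seq nat) (dl : nat -> nat -> Prop).
Hypothesis u_sorted : forall i, sorted (fun a b => b < a)%N (u i).
Hypothesis u_large : forall i, (L <= i)%N -> u i = [::].
Hypothesis run_neq0 : forall i, (i < L)%N -> u i = [::] -> exists c, dl i c.

Definition shift_ok s : Prop :=
  [/\ forall i c, dl i c -> odd (count (ltn^~ c) (u i) + count (ltn c) (u i.+1)),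
      zero_ok (u s),
      forall i, (s <= i)%N -> forward_ok ltn (u i) (u i.+1)
    & forall i, (i < s)%N -> forward_ok gtn (u i.+1) (u i)].

(** Size at most 2 spreads from the zero run in both directions, and so does emptiness away from it;
    hence only run 0 can lack undecorated letters. Nonempty neighbours satisfy the forward and
    backward conditions together, so all conclusions but the first are independent of [s]. *)
Lemma shift_ok_structure s : (s < L)%N -> shift_ok s ->
  [/\ size (u s) = 1%N, forall i, (size (u i) <= 2)%N,
      forall i, (i.+1 < L)%N -> u i.+1 <> [::],
      forall i, (i.+1 < L)%N -> forward_ok gtn (u i.+1) (u i)
    & forall i, u i <> [::] -> forward_ok ltn (u i) (u i.+1)].
Proof.
move=> lt_sL [dec_ok z_ok f_ok b_ok].
have size_s := zero_ok_size (u_sorted s) z_ok.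
(* A run without undecorated letters has a decorated one, whose odd schedule number counts only
   undecorated letters of this run and the next. *)
have not_both i : (i < L)%N -> u i = [::] -> u i.+1 <> [::].
  move=> lt_iL ui0 ui1; have [c] := run_neq0 lt_iL ui0.
  by move/dec_ok; rewrite ui0 ui1.
have size_up j : (size (u (s + j)) <= 2)%N.
  elim: j => [|j IHj]; first by rewrite addn0; lia.
  rewrite addnS; have [] // := forward_step ltn_trans ltnn (u_sorted _) IHj (f_ok _ _).
  exact: leq_addr.
have size_down j : (j <= s)%N -> (size (u (s - j)) <= 2)%N.
  elim: j => [|j IHj] lt_js; first by rewrite subn0; lia.
  have [] // := @backward_step (u (s - j.+1)) (u (s - j.+1).+1) (u_sorted _).
    by rewrite subnSK // IHj // ltnW.
  by apply: b_ok; lia.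
have size2 i : (size (u i) <= 2)%N.
  case: (leqP s i) => le_si; first by rewrite -(subnKC le_si).
  by rewrite -(subKn (ltnW le_si)) size_down // leq_subr.
have up0 i : (s <= i)%N -> u i = [::] -> u i.+1 = [::].
  move=> le_si; have [_ _] := forward_step ltn_trans ltnn (u_sorted _) (size2 _) (f_ok _ le_si).
  exact.
have down0 i : (i < s)%N -> u i.+1 = [::] -> u i = [::].
  by move=> lt_is; have [_ _] := backward_step (u_sorted _) (size2 _) (b_ok _ lt_is).
have nonempty_up i : (s <= i < L)%N -> u i <> [::].
  by move=> /andP[le_si lt_iL] ui0; apply: not_both lt_iL ui0 (up0 _ le_si ui0).
have nonempty i : (i.+1 < L)%N -> u i.+1 <> [::].
  move=> lt_iL ui0; case: (leqP s i.+1) => le_si.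
    by apply: (@nonempty_up i.+1); rewrite ?le_si.
  exact: (not_both i (ltnW lt_iL) (down0 i (ltnW le_si) ui0) ui0).
have size_gt0 i : u i <> [::] -> (0 < size (u i))%N by case: (u i).
have us0 : u s <> [::] by apply: nonempty_up; rewrite leqnn.
split=> //.
- by have := size_gt0 s us0; lia.
- move=> i lt_iL; case: (ltnP i s) => [/b_ok//|le_si].
  rewrite -forward_backward ?f_ok ?size2 ?andbT //; apply: size_gt0.
    by apply: nonempty_up; rewrite le_si ltnW.
  exact: nonempty.
- move=> i ui0; case: (leqP s i) => [/f_ok//|lt_is].
  rewrite forward_backward ?b_ok ?size2 ?andbT //; apply: size_gt0 => //.
  by apply: nonempty; apply: leq_ltn_trans lt_sL.
Qed.

Lemma shift_ok_transfer s s' : (s < L)%N -> (s' < L)%N -> shift_ok s ->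
  size (u s') = 1%N -> shift_ok s'.
Proof.
move=> lt_sL lt_s'L ok_s size_s'; have [dec_ok _ _ _] := ok_s.
have [_ size2 nonempty b_ok f_ok] := shift_ok_structure lt_sL ok_s.
split=> //.
- by case: (u s') size_s' => [//|c [|//]] _; rewrite /zero_ok /= ltnn.
- move=> i le_i; case: (ltnP i.+1 L) => lt_iL; last by rewrite (u_large lt_iL).
  apply: f_ok; case: i le_i lt_iL => [|i] le_i lt_iL.
    (* Run 0, which could be empty, is here the zero run [s'] itself and has one letter. *)
    by move: le_i size_s'; rewrite leqn0 => /eqP-> + u0; rewrite u0.
  by apply: nonempty; apply: ltnW.
- by move=> i lt_is; apply: b_ok; apply: leq_ltn_trans lt_s'L.
Qed.

Lemma shift_ok_one s : (s < L)%N -> shift_ok s ->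
  [/\ forall i c, dl i c -> (count (ltn^~ c) (u i) + count (ltn c) (u i.+1) = 1)%N,
      forall c, c \in u s -> count (ltn c) (u s) = 0%N,
      forall i c, (s <= i)%N -> c \in u i.+1 ->
        (count (ltn c) (u i.+1) + count (ltn^~ c) (u i) = 1)%N
    & forall i c, (i < s)%N -> c \in u i ->
        (count (ltn^~ c) (u i) + count (ltn c) (u i.+1) = 1)%N].
Proof.
move=> lt_sL ok_s; have [dec_ok _ f_ok b_ok] := ok_s.
have [size_s size2 _ _ f_ok'] := shift_ok_structure lt_sL ok_s.
split.
- move=> i c /dec_ok; apply: interlaced_parity => // /eqP ui0 _; exact: f_ok'.
- case: (u s) size_s => [|c0 []] // _ c; rewrite inE => /eqP->.
  by rewrite /= ltnn.
- move=> i c le_si.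
  have [_ /allP h _] := forward_step ltn_trans ltnn (u_sorted _) (size2 _) (f_ok _ le_si).
  by move/h/eqP.
- move=> i c lt_is.
  have [_ /allP h _] := backward_step (u_sorted _) (size2 _) (b_ok _ lt_is).
  by move/h/eqP.
Qed.

End Alternation.

(** Values 0 and 2 of [a] contribute nothing and keep the parity of [W]; a value 1 flips it,
    contributing +1 from even to odd and -1 back. *)
Lemma alternating_sum (a W : nat -> nat) m : W 0%N = 0%N ->
  (forall i, (i < m)%N -> W i.+1 = W i + a i /\ a i <= 2)%N ->
  \sum_(s < m) (-1) ^+ W s * (a s == 1%N)%:R = (odd (W m))%:R :> int.
Proof.
move=> W0; elim: m => [|m IHm] h; first by rewrite big_ord0 W0.
rewrite big_ord_recr /= IHm => [|i lt_im]; last by apply: h; apply: ltnW.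
have [-> le2] := h m (ltnSn m); rewrite -signr_odd oddD.
case: (a m) le2 => [|[|[|]]] //= _; case: (odd (W m)) => /=; ring.
Qed.

(** * Cancellation among the shifts of one decorated permutation *)

Section DecoratedPermutation.

Variables (n : nat) (sigma : 'S_n) (D : {set 'I_n}).

Let L := size (runs sigma).
Let u (i : nat) : seq nat := [seq val d | d <- undecorated_run sigma D i].
Let dl (i c : nat) : Prop :=
  exists d : 'I_n, [/\ c = d, d \in D & run_index sigma d = i].

Lemma scheduleE (s : nat) (c : 'I_n) : (s < L)%N -> let i := run_index sigma c in
  schedule sigma D s c =
  if (i < s)%N || (c \in D) then (count (ltn^~ c) (u i) + count (ltn c) (u i.+1))%N
  else if i == s then (count (ltn c) (u i)).+1
  else (count (ltn c) (u i) + count (ltn^~ c) (u i.-1))%N.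
Proof. by move=> lt_sL /=; rewrite /schedule leqNgt lt_sL /= !count_map addn1. Qed.

Lemma mem_undecorated (d : 'I_n) i :
  (val d \in u i) = (run_index sigma d == i) && (d \notin D).
Proof.
rewrite mem_map; last exact: val_inj.
rewrite mem_filter andbC /runs nth_flatten_find flatten_decreasing_runs ?uniq_word //.
by rewrite mem_filter mem_word andbT.
Qed.

Lemma undecorated_mem c i : c \in u i ->
  exists d : 'I_n, [/\ c = d, d \notin D & run_index sigma d = i].
Proof.
move=> u_c; have [d _ c_d] := mapP u_c; exists d.
by move: u_c; rewrite c_d mem_undecorated => /andP[/eqP-> ->].
Qed.

Lemma undecorated_sorted i : sorted (fun a b => b < a)%N (u i).
Proof.
rewrite /u sorted_map; apply: sorted_filter.
  by move=> a b c /= ab bc; apply: ltn_trans bc ab.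
case: (ltnP i L) => lt_iL; last by rewrite nth_default.
exact: (allP (decreasing_runs_sorted (word sigma)) _ (mem_nth [::] lt_iL)).
Qed.

Lemma undecorated_large i : (L <= i)%N -> u i = [::].
Proof. by move=> le_Li; rewrite /u /undecorated_run nth_default. Qed.

Lemma run_decorated i : (i < L)%N -> u i = [::] -> exists c, dl i c.
Proof.
move=> lt_iL ui0.
have := allP (decreasing_runs_neq0 (word sigma)) _ (mem_nth [::] lt_iL).
rewrite nth_flatten_find flatten_decreasing_runs ?uniq_word //.
rewrite size_filter -has_count => /hasP[d _ /eqP ri_d]; exists d, d; split=> //.
have := mem_undecorated d i; rewrite ui0 -[run_index _ _]/(find _ _) ri_d eqxx.
by case: (d \in D).
Qed.

Lemma shift_okP s : (s < L)%N ->
  reflect (shift_ok u dl s) [forall c, odd (schedule sigma D s c)].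
Proof.
move=> lt_sL; apply: (iffP forallP) => [h|[dec_ok z_ok f_ok b_ok] c].
  split.
  - move=> i _ [d [-> D_d <-]]; have := h d.
    by rewrite scheduleE // D_d orbT.
  - apply/allP=> c u_c; have [d [c_d D_d ri_d]] := undecorated_mem u_c.
    by have := h d; rewrite scheduleE // (negPf D_d) ri_d ltnn eqxx c_d.
  - move=> i le_si; apply/allP=> c u_c; have [d [c_d D_d ri_d]] := undecorated_mem u_c.
    have := h d; rewrite scheduleE // (negPf D_d) ri_d orbF ltnNge leqW //=.
    by rewrite gtn_eqF ?ltnS // c_d.
  - move=> i lt_is; apply/allP=> c u_c; have [d [c_d D_d ri_d]] := undecorated_mem u_c.
    by have := h d; rewrite scheduleE // ri_d lt_is c_d.
rewrite scheduleE //; set i := run_index sigma c.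
case: (boolP (c \in D)) => D_c; rewrite ?orbT ?orbF.
  by apply: dec_ok; exists c.
have u_c : val c \in u i by rewrite mem_undecorated eqxx.
case: ltngtP => [lt_is|lt_si|eq_is].
- exact: (allP (b_ok i lt_is)).
- have eq_i := prednK (leq_ltn_trans (leq0n s) lt_si).
  by rewrite -{1}eq_i; apply: (allP (f_ok i.-1 _)); rewrite ?eq_i // -ltnS eq_i.
- by move: u_c; rewrite eq_is => /(allP z_ok).
Qed.

Lemma schedule_one s : (s < L)%N -> shift_ok u dl s ->
  forall c, schedule sigma D s c = 1%N.
Proof.
move=> lt_sL ok_s c.
have [dec1 z1 f1 b1] := shift_ok_one undecorated_sorted run_decorated lt_sL ok_s.
rewrite scheduleE //; set i := run_index sigma c.
case: (boolP (c \in D)) => D_c; rewrite ?orbT ?orbF.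
  by apply: dec1; exists c.
have u_c : val c \in u i by rewrite mem_undecorated eqxx.
case: ltngtP => [lt_is|lt_si|eq_is].
- exact: b1.
- have eq_i := prednK (leq_ltn_trans (leq0n s) lt_si).
  by rewrite -{1}eq_i; apply: f1; rewrite ?eq_i // -ltnS eq_i.
- by rewrite eq_is z1 // -eq_is.
Qed.

Let W s := #|[set c | (run_index sigma c < s)%N && (c \notin D)]|.

Lemma sum_shifts :
  \sum_(s < L) (-1) ^+ W s * [forall c, odd (schedule sigma D s c)]%:R =
  (odd (n - #|D|) && [exists s : 'I_L, forall c, schedule sigma D s c == 1%N])%:R
  :> int.
Proof.
case: (boolP [exists s : 'I_L, _]) => [/existsP[s0 /forallP s0_one]|none]; last first.
  rewrite andbF big1 // => s _; case: (shift_okP (ltn_ord s)) => [ok_s|_]; last by rewrite mulr0.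
  case/negP: none; apply/existsP; exists s; apply/forallP=> c.
  by rewrite (schedule_one (ltn_ord s) ok_s).
have ok0 : shift_ok u dl s0.
  by apply/(shift_okP (ltn_ord s0))/forallP=> c; rewrite (eqP (s0_one c)).
have strP := shift_ok_structure undecorated_sorted run_decorated.
have [_ size2 _ _ _] := strP _ (ltn_ord s0) ok0.
under eq_bigr => s _.
  (* Once one shift works, the others that work are those whose zero run has a single undecorated
     letter. *)
  have -> : [forall c, odd (schedule sigma D s c)] = (size (u s) == 1%N).
    apply/(shift_okP (ltn_ord s))/eqP => [ok_s|size1].
      by have [] := strP _ (ltn_ord s) ok_s.
    exact: (shift_ok_transfer undecorated_sorted undecorated_large run_decorated
              (ltn_ord s0) (ltn_ord s) ok0 size1).
  over.
rewrite (@alternating_sum (fun i => size (u i)) W L).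
- rewrite andbT; congr (nat_of_bool (odd _))%:R.
  rewrite /W (_ : [set c | _] = ~: D); first by rewrite cardsCs setCK card_ord.
  by apply/setP=> c; rewrite !inE run_index_lt.
- by apply: eq_card0 => c; rewrite inE.
move=> i _; split=> //.
rewrite /W -!sum1dep_card size_map -(count_predT (undecorated_run _ _ _)).
rewrite count_undecorated_run big_mkcond [X in (X + _)%N]big_mkcond -big_split.
apply: eq_bigr => c _ /=; case: (c \in D); rewrite /= ?andbF ?andbT //.
by rewrite ltnS; case: (ltngtP (run_index sigma c) i).
Qed.

End DecoratedPermutation.

(** * From level functions to permutations, and conclusion *)

Lemma S_poly_shifts n k (n_gt0 : (0 < n)%N) : S_poly n k =
  \sum_(sigma : 'S_n) \sum_(D : {set 'I_n} | #|D| == k)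
    (\sum_(s < size (runs sigma))
       (-1) ^+ #|[set c | (run_index sigma c < s)%N && (c \notin D)]|
       * [forall c, odd (schedule sigma D s c)]%:R)
    *: 'X^(revmaj sigma).
Proof.
rewrite (S_poly_product n_gt0).
set F := fun l : {ffun 'I_n -> 'I_n.*2} => \sum_(D : {set 'I_n} | #|D| == k)
    ((-1) ^+ #|[set c | (l c < n)%N && (c \notin D)]|
      * [forall c, odd (level_schedule l D c)]%:R)
    *: 'X^(\sum_c (l c - min_level n_gt0 l)) : {poly int}.
rewrite -[LHS]/(\sum_l F l).
set A := [set x : 'S_n * 'I_n | (x.2 < size (runs x.1))%N].
(* A level function outside the image admits no valid word, so for every [D] some schedule number is
   even and its term vanishes. *)
transitivity (\sum_(l in @shifted_levels n @: A) F l).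
  rewrite [RHS]big_mkcond; apply: eq_bigr => l _; case: ifPn => // notA.
  rewrite /F big1 // => D _; case: forallP => [h|_]; last by rewrite mulr0 scale0r.
  have [w v] : exists w, valid_word l w D.
    by apply: (odd_schedule_valid n_gt0); apply/forallP.
  have [x [x_A x_l]] := valid_levels_shifted n_gt0 v.
  by case/imsetP: notA; exists x; rewrite ?inE.
rewrite big_imset; last by move=> x y _ _; apply: (shifted_levels_inj n_gt0).
transitivity (\sum_(sigma : 'S_n) \sum_(s : 'I_n | (s < size (runs sigma))%N)
    F (shifted_levels (sigma, s))).
  by rewrite [RHS]pair_big_dep; apply: eq_big => [[sigma s]|[sigma s] _]; rewrite ?inE.
apply: eq_bigr => sigma _; rewrite (big_ord_narrow (size_runs sigma)) exchange_big /=.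
apply: eq_bigr => D _; rewrite scaler_suml; apply: eq_bigr => s _.
rewrite area_shifted; congr ((_ ^+ _ * (nat_of_bool _)%:R) *: _).
  apply: eq_card => c; rewrite !inE shifted_levelE /=.
  by have := ltn_ord s; have := size_runs sigma; case: (c \in D); rewrite ?andbF //= !andbT; lia.
by apply: eq_forallb => c; rewrite level_schedule_shifted /=.
Qed.

Theorem mainTheorem1 (n k : nat) (n_gt0 : (0 < n)%N) :
  S_poly n k =
    if odd (absz (n%:Z - k%:Z))
    then \sum_(x in ADR n k) 'X^(revmaj x.1)
    else 0.
Proof.
have -> : (if odd (absz (n%:Z - k%:Z))
    then \sum_(x in ADR n k) 'X^(revmaj x.1) else 0 : {poly int}) =
    \sum_(x in ADR n k) (odd (absz (n%:Z - k%:Z)))%:R *: 'X^(revmaj x.1).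
  by case: odd; [under [RHS]eq_bigr do rewrite scale1r
                | rewrite big1 // => x _; rewrite scale0r].
rewrite (S_poly_shifts k n_gt0) pair_big_dep [LHS]big_mkcond [RHS]big_mkcond /=.
apply: eq_bigr => -[sigma D] _; rewrite inE /=.
case: eqP => //= card_D; rewrite sum_shifts // card_D.
(* For k > n no set [D] qualifies; otherwise the absolute value is the natural difference. *)
have le_kn : (k <= n)%N by rewrite -card_D -[X in (_ <= X)%N](card_ord n) max_card.
rewrite (_ : absz (n%:Z - k%:Z) = (n - k)%N); last by lia.
by case: [exists s, _]; rewrite ?andbT ?andbF ?scale0r.
Qed.
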